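(* Let $1<p<\infty$ and assume that $w\in A_p$. Then there exists $\varepsilon=\varepsilon(c_\mu,p,[w]_{A_p})$ such that $0<\varepsilon<p-1$, $w\in A_{p-\varepsilon}$ and $[w]_{A_{p-\varepsilon}}\le C(c_\mu,p,[w]_{A_p})$. Moreover, \[ \int_{X} \bigl(M^{*} f(x)\bigr)^{p-\varepsilon} w(x)\,d\mu(x) \le C(c_\mu,p,[w]_{A_p})\int_{X} \lvert f(x)\rvert^{p-\varepsilon} w(x)\,d\mu(x) \] for all $f\in L^{p-\varepsilon}(w\,d\mu)$.
   Context: $X=(X,d,\mu)$ is a metric measure space with a metric $d$ and a positive complete Borel measure $\mu$ such that $0<\mu(B)<\infty$ for all open balls $B=B(x,r)=\{y\in X: d(y,x)<r\}$, $x\in X$, $r>0$. All balls are such open balls. It is assumed that $X$ has at least two points and that $\mu$ is doubling: there is a constant $c_\mu>1$ with $\mu(B(x,2r))\le c_\mu\,\mu(B(x,r))$ for all $x\in X$, $r>0$. A measurable function $w\colon X\to\mathbb{R}$ is a weight in $X$ if $w$ is integrable (with respect to $\mu$) on all balls of $X$ and $w(x)>0$ for almost every $x\in X$. A weight $w$ belongs to the Muckenhoupt class $A_q$, $1<q<\infty$, if there is a constant $C$ such that \[ \left(\frac{1}{\mu(B)}\int_B w\,d\mu\right)\left(\frac{1}{\mu(B)}\int_B w^{\frac{1}{1-q}}\,d\mu\right)^{q-1}\le C \] for every ball $B\subset X$; the smallest such constant is denoted $[w]_{A_q}$. For $1\le q<\infty$, $L^q(w\,d\mu)$ is the set of measurable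 functions $f$ on $X$ with $\int_X |f|^q w\,d\mu<\infty$. The noncentered Hardy--Littlewood maximal function of a measurable function $f$ is \[ M^{*}f(x)=\sup_{B\ni x}\frac{1}{\mu(B)}\int_B |f(y)|\,d\mu(y), \] where the supremum is over all balls $B$ in $X$ containing $x$. The notation $C(a,b,\dots)$ means a constant depending only on the listed parameters (possibly different at each occurrence). *)

(* Defs.v *)
From HB Require Import structures.
From mathcomp Require Import all_boot all_order all_algebra.
From mathcomp Require Import all_classical all_reals all_analysis.
From mathcomp Require Import measurable_realfun.

Set Implicit Arguments.
Unset Strict Implicit.
Unset Printing Implicit Defensive.
Import Order.TTheory GRing.Theory Num.Theory.
Import numFieldNormedType.Exports.

Local Open Scope classical_set_scope.
Local Open Scope ring_scope.
Local Open Scope ereal_scope.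

#[short(type="metricMeasurableType")]
HB.structure Definition MetricMeasurable (R : numDomainType)
    (d : measure_display) :=
  {T of Metric R T & Measurable d T}.

Section maximal_Muckenhoupt.
Context {R : realType} {d : measure_display} {X : metricMeasurableType R d}.
Variable mu : {measure set X -> \bar R}.

(* The measurable sets of X are exactly the sets in the mu-completion of the
   Borel sigma-algebra of the metric. Bare completeness on some sigma-algebra
   containing the Borel sets would not be enough: Lebesgue's differentiation
   theorem can then fail for measurable functions. *)
Definition complete_borel_measure : Prop :=
  forall A : set X, measurable A <->
    exists B1 B2 : set X,
      [/\ <<s open >> B1, <<s open >> B2, B1 `<=` A, A `<=` B2 &
          mu (B2 `\` B1) = 0].

Definition ball_measure_pos_finite : Prop :=
  forall (x : X) (r : R), (0 < r)%R ->
    0 < mu (ball x r) /\ mu (ball x r) < +oo.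

Definition doubling (c : R) : Prop :=
  forall (x : X) (r : R), (0 < r)%R ->
    mu (ball x (2 * r)%R) <= c%:E * mu (ball x r).

Definition average (B : set X) (g : X -> \bar R) : \bar R :=
  (mu B)^-1 * \int[mu]_(y in B) g y.

Definition weight (w : X -> R) : Prop :=
  [/\ measurable_fun setT w,
      (forall (x : X) (r : R), (0 < r)%R ->
        mu.-integrable (ball x r) (EFin \o w)) &
      {ae mu, forall x, (0 < w x)%R}].

Definition Muckenhoupt_bound (q : R) (w : X -> R) (C : R) : Prop :=
  forall (x : X) (r : R), (0 < r)%R ->
    average (ball x r) (fun y => (w y)%:E) *
    (average (ball x r) (fun y => (w y `^ (1 / (1 - q)))%:E)) `^ (q - 1)
    <= C%:E.

Definition Muckenhoupt (q : R) (w : X -> R) : Prop :=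
  weight w /\ exists C : R, Muckenhoupt_bound q w C.

(* Only meaningful when w is in the class A_q, as the real infimum of the
   empty set is 0; otherwise the infimum is attained. *)
Definition Muckenhoupt_const (q : R) (w : X -> R) : R :=
  inf [set C : R | Muckenhoupt_bound q w C].

Definition weighted_Lq (q : R) (w : X -> R) (f : X -> \bar R) : Prop :=
  measurable_fun setT f /\ \int[mu]_x (`|f x| `^ q * (w x)%:E) < +oo.

Definition maximal (f : X -> \bar R) (x : X) : \bar R :=
  ereal_sup [set average (ball z.1 z.2) (fun y => `|f y|) |
    z in [set z : X * R | (0 < z.2)%R /\ ball z.1 z.2 x]].

End maximal_Muckenhoupt.

(* Main.v *)
Require Import Defs.
From HB Require Import structures.
From mathcomp Require Import all_boot all_order all_algebra.
From mathcomp Require Import all_classical all_reals all_analysis.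
From mathcomp Require Import measurable_realfun.
From mathcomp Require Import finmap zify lra ring.
Set Implicit Arguments.
Unset Strict Implicit.
Unset Printing Implicit Defensive.
Import Order.TTheory GRing.Theory Num.Theory.
Import numFieldNormedType.Exports.

Local Open Scope classical_set_scope.
Local Open Scope ring_scope.
Local Open Scope ereal_scope.

(** The improvement is first obtained for the maximal operator, and only then
for the weight.  Write U(l) for the set where the maximal function of f exceeds
l, and w(E) for the integral of w over E.  The A_p condition and a Vitali
covering give at once the weak type inequality
[l^p w(U(l)) <= C int f^p w].  The gain in the exponent comes from applying it
not to f but to a better function.  For a level L > l, replace f by L on U(L).
A ball on which the average of f is about l still has, after this replacement
and a bounded enlargement, an average of at least a multiple of l, because U(L)
is covered by balls on which the average of f is about L
([truncation_average]).  The same is true of the mean h of these truncations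
over the levels a l, ..., a^n l.  But where the maximal function is about
a^i l, the contribution of the replaced values to h is only about (a^i l) / n,
as the levels are geometric.  Hence the weak type inequality for h reads
[[
  l^p w(U(l)) <= D (n^-p sum_(1 <= i <= n) (a^i l)^p w(U(a^i l))
                    + int_{l/2 < f <= a^(n+1) l} f^p w)
]]
([level_estimate]).  Multiply by l^-e and sum over l in a geometric progression
of ratio a: the first sum on the right becomes at most D n^(1-p) a^(n e) times
the left-hand side.  As p > 1, a large n makes D n^(1-p) small, and then a
small e keeps a^(n e) below 2, so that this term is absorbed
([level_sum]).  In the second term each value of f is counted at most n + 2
times, and its sum is controlled by the integral of f^(p-e) w.  This is the
strong type inequality with exponent p - e for bounded functions with bounded
support and for radii bounded from above; Fatou's lemma removes these
restrictions ([strong_type]).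

The A_q condition for q = p - e then follows by testing the strong type
inequality with truncations of w^(1/(1-q)) on a ball
([muckenhoupt_of_strong_type]).

All coverings are packed into one comparison of integrals,
[covering_comparison].  It also yields the bound f <= C M f almost everywhere
([le_superlevel_ae]), a substitute for Lebesgue's differentiation theorem that
needs only that measurable sets can be enclosed in open sets of almost the same
measure ([outer_regular]); this rests on the sigma-algebra being the completed
Borel one. *)

(** * Vitali families and integrals of nonnegative functions *)

(** Vitali's selection with radii encoded by a rank, a smaller rank meaning a
larger ball: no metric is needed.  Zorn's lemma applies to the disjoint
subfamilies D such that whatever meets a member of D also meets one of smaller
or equal rank.  If a member of V met nothing in a maximal D, one of minimal rank
could be added to D. *)
Lemma ranked_vitali (I T : Type) (B : I -> set T) (rank : I -> nat)
    (V : set I) :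
  (forall i, B i !=set0) ->
  exists D : set I, [/\ D `<=` V, trivIset D B &
    forall i, V i ->
      exists j, [/\ D j, (rank j <= rank i)%N & B i `&` B j !=set0]].
Proof.
move=> B0.
pose P (D : set I) := [/\ D `<=` V, trivIset D B &
  forall i j, V i -> D j -> B i `&` B j !=set0 ->
    exists k, [/\ D k, (rank k <= rank i)%N & B i `&` B k !=set0]].
have [D [[DV tD PD] maxD]] : exists D, P D /\ forall C, D `<` C -> ~ P C.
  apply: Zorn_bigcup => F FP tF; split.
  - by apply: bigcup_sub => A /FP[].
  - move=> i j [A FA Ai] [C FC Cj]; have [AC|CA] := tF _ _ FA FC.
    + by have [_ + _] := FP _ FC; apply => //; exact: AC.
    + by have [_ + _] := FP _ FA; apply => //; exact: CA.
  - move=> i j Vi [A FA Aj] ij; have [_ _ /(_ i j Vi Aj ij)] := FP _ FA.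
    by move=> [k [Ak ki Bik]]; exists k; split => //; exists A.
exists D; split => // i Vi; apply: contrapT => noj.
pose Q n := `[< exists j, [/\ V j, rank j = n &
  forall k, D k -> ~ (B j `&` B k !=set0)] >].
have exQ : exists n, Q n.
  exists (rank i); apply/asboolP; exists i; split => // k Dk ik.
  by have [l Hl] := PD _ _ Vi Dk ik; apply: noj; exists l.
case: (ex_minnP exQ) => m /asboolP[j [Vj rj Dj]] minm.
apply: (maxD (D `|` [set j])).
  split; first by move=> x Dx; left.
  by move=> /(_ j (or_intror erefl)) Djj; apply: (Dj _ Djj); rewrite setIid.
split.
- by move=> x [/DV//|->].
- move=> x y [Dx|->] [Dy|->] //.
  + exact: tD.
  + by rewrite setIC => /(Dj _ Dx).
  + by move/(Dj _ Dy).
- move=> x y Vx Dy xy.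
  have [[z Dz xz]|nz] := pselect (exists2 z, D z & B x `&` B z !=set0).
    have [k [Dk kx Bxk]] := PD _ _ Vx Dz xz.
    by exists k; split => //; left.
  exists j; split; first by right.
    rewrite rj; apply: minm; apply/asboolP; exists x; split => // k Dk xk.
    by apply: nz; exists k.
  by case: Dy => [Dy|<- //]; exfalso; apply: nz; exists y.
Qed.

Section integral_of_nonnegative.
Context {d : measure_display} {T : measurableType d} {R : realType}.
Variable mu : {measure set T -> \bar R}.

(** Only finitely many disjoint sets of measure at least 1/(n+1) fit in a set of
finite measure. *)
Lemma countable_disjoint_pos (I : choiceType) (D : set I) (B : I -> set T)
    (S : set T) :
  measurable S -> mu S < +oo ->
  (forall i, D i -> [/\ measurable (B i), B i `<=` S & 0 < mu (B i)]) ->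
  trivIset D B -> countable D.
Proof.
move=> mS Soo DB tD.
have -> : D = \bigcup_n (D `&` [set i | (n.+1%:R^-1)%:E <= mu (B i)]).
  apply/seteqP; split => [i Di|i [n _ []]//].
  have [mB BS B0] := DB _ Di.
  have Boo : mu (B i) < +oo by apply: le_lt_trans Soo; apply: le_measure => //; exact/mem_set.
  have e0 : (0 < fine (mu (B i)))%R by rewrite fine_gt0// B0.
  have [n _ /(_ n (leqnn n))/= h] := near_infty_natSinv_lt (PosNum e0).
  exists n => //; split => //=.
  by rewrite -[leRHS]fineK ?ge0_fin_numE// lee_fin ltW.
apply: bigcup_countable => // n _; apply: finite_set_countable.
apply: contrapT => inf.
pose N := (Num.truncn (fine (mu S) * n.+1%:R)).+1.
have [F FD FN] := infinite_set_fset N inf.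
have FB i : i \in F -> [/\ measurable (B i), B i `<=` S &
    (n.+1%:R^-1)%:E <= mu (B i)].
  by move=> /FD[/DB[? ? _]].
have : mu (\big[setU/set0]_(i <- F) B i) <= mu S.
  rewrite -bigcup_fset; apply: le_measure; [apply/mem_set|exact/mem_set|].
    by apply: fin_bigcup_measurable => // i /FB[].
  by apply: bigcup_sub => i /FB[].
rewrite measure_fbigsetU; last 2 first.
- by move=> i /FB[].
- by apply: sub_trivIset tD => i /FD[].
apply/negP; rewrite -ltNge.
have : \sum_(i <- F) (n.+1%:R^-1)%:E <= \sum_(i <- F) mu (B i).
  by rewrite big_seq [leRHS]big_seq; apply: lee_sum => i /FB[].
apply: lt_le_trans; rewrite sumEFin big_const_seq iter_addr addr0 count_predT.
rewrite -[ltLHS]fineK ?ge0_fin_numE// lte_fin.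
rewrite -[ltRHS]mulr_natl ltr_pdivlMr//.
rewrite (lt_le_trans (truncnS_gt _))// ler_nat.
exact: FN.
Qed.

Lemma ge0_integral_bigcup_le (G : (set T)^nat) (f : T -> \bar R) :
  (forall k, measurable (G k)) -> measurable_fun setT f ->
  (forall x, 0 <= f x) ->
  \int[mu]_(x in \bigcup_k G k) f x <= \sum_(k <oo) \int[mu]_(x in G k) f x.
Proof.
move=> mG mf f0.
have mD k : measurable (seqDU G k).
  by rewrite /seqDU; apply: measurableD => //; exact: bigsetU_measurable.
rewrite seqDU_bigcup_eq ge0_integral_bigcup//; last exact: measurable_funTS.
apply: lee_nneseries => [n _ _|n _]; first exact: integral_ge0.
apply: ge0_subset_integral => //; first exact: measurable_funTS.
by move=> x [].
Qed.

Lemma subset_integral_EFin (f : T -> R) (A B : set T) :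
  measurable A -> measurable B -> measurable_fun setT f ->
  (forall x, (0 <= f x)%R) -> A `<=` B ->
  \int[mu]_(x in A) (f x)%:E <= \int[mu]_(x in B) (f x)%:E.
Proof.
move=> mA mB mf f0 AB; apply: ge0_subset_integral => //.
  by apply: measurable_funTS; exact/measurable_EFinP.
by move=> x _; rewrite lee_fin.
Qed.

Lemma le_integral_EFin (f g : T -> R) (A : set T) :
  measurable A -> measurable_fun setT f -> measurable_fun setT g ->
  (forall x, (0 <= f x)%R) -> (forall x, A x -> (f x <= g x)%R) ->
  \int[mu]_(x in A) (f x)%:E <= \int[mu]_(x in A) (g x)%:E.
Proof.
move=> mA mf mg f0 fg; apply: ge0_le_integral => //.
- by move=> x _; rewrite lee_fin.
- by apply: measurable_funTS; exact/measurable_EFinP.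
- by apply: measurable_funTS; exact/measurable_EFinP.
Qed.

Lemma measurable_gt_set (f : T -> R) (a : R) :
  measurable_fun setT f -> measurable [set x | (a < f x)%R].
Proof.
move=> mf; rewrite (_ : [set x | _] = f @^-1` `]a, +oo[%classic).
  by rewrite -[X in measurable X]setTI; apply: mf.
by apply/seteqP; split => x /=; rewrite in_itv/= andbT.
Qed.

Lemma measurable_le_set (f : T -> R) (a : R) :
  measurable_fun setT f -> measurable [set x | (f x <= a)%R].
Proof.
move=> mf; rewrite (_ : [set x | _] = ~` [set x | (a < f x)%R]).
  exact/measurableC/measurable_gt_set.
by apply/seteqP; split => x /=; [rewrite leNgt => /negP|move/negP; rewrite -leNgt].
Qed.

End integral_of_nonnegative.

(** * Hoelder's inequality with a weight *)
Section weighted_hoelder.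
Context {d : measure_display} {T : measurableType d} {R : realType}.
Variable mu : {measure set T -> \bar R}.

(** This is where the exponent 1/(1-p) of the A_p condition comes from: write
g = (g w^(1/p)) w^(-1/p). *)
Lemma weighted_hoelder (p : R) (w g : T -> R) (B : set T) :
  (1 < p)%R -> measurable B ->
  measurable_fun setT w -> (forall x, (0 < w x)%R) ->
  measurable_fun setT g -> (forall x, (0 <= g x)%R) ->
  (\int[mu]_(x in B) (g x)%:E) `^ p <=
  (\int[mu]_(x in B) (g x `^ p * w x)%:E) *
  (\int[mu]_(x in B) (w x `^ (1 / (1 - p)))%:E) `^ (p - 1).
Proof.
move=> p1 mB mw w0 mg g0.
have p0 : (0 < p)%R by lra.
have pN0 : p != 0%R by rewrite gt_eqF.
have p10 : (p - 1 != 0)%R by rewrite gt_eqF//; lra.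
pose q := (p / (p - 1))%R.
have q0 : (0 < q)%R by rewrite divr_gt0//; lra.
have qN0 : q != 0%R by rewrite gt_eqF.
have pq : (p^-1 + q^-1 = 1)%R by rewrite /q; field; rewrite ?pN0 ?p10.
have mpow (h : T -> R) s : measurable_fun setT h ->
    measurable_fun setT (fun x => h x `^ s)%R.
  by move=> mh; apply: (measurableT_comp (measurable_powR _) mh).
pose F x := (\1_B x * (g x * w x `^ p^-1))%R.
pose G x := (\1_B x * (w x `^ (- p^-1)))%R.
have mI : measurable_fun setT (\1_B : T -> R) by exact: measurable_indic.
have mF : measurable_fun setT F.
  by apply: measurable_funM => //; apply: measurable_funM => //; exact: mpow.
have mG : measurable_fun setT G.
  by apply: measurable_funM => //; exact: mpow.
have ind (h : T -> R) : \int[mu]_(x in B) (h x)%:E =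
    \int[mu]_x (\1_B x * h x)%:E.
  rewrite integral_mkcond; apply: eq_integral => x _.
  rewrite /patch indicE; case: ifP => _; first by rewrite mul1r.
  by rewrite mul0r.
have := hoelder mu mF mG p0 q0 pq.
rewrite Lnorm1 => H.
have wp x : (w x `^ p^-1 * w x `^ (- p^-1) = 1)%R.
  by rewrite powRN mulfV// gt_eqF// powR_gt0.
have E1 : \int[mu]_x `|(EFin \o (F \* G)%R) x| = \int[mu]_(x in B) (g x)%:E.
  rewrite ind; apply: eq_integral => x _; rewrite /= ger0_norm; last first.
    by rewrite !mulr_ge0// ?powR_ge0// indicE.
  congr EFin; rewrite /F /G mulrACA -[X in (_ * X)%R]mulrA wp mulr1.
  by rewrite indicE; case: (x \in B); rewrite /= ?mul1r ?mul0r.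
have E2 : 'N[mu]_p%:E[EFin \o F] `^ p = \int[mu]_(x in B) (g x `^ p * w x)%:E.
  rewrite poweR_Lnorm// ind; apply: eq_integral => x _.
  rewrite /= ger0_norm; last by rewrite !mulr_ge0// ?powR_ge0// indicE.
  congr EFin; rewrite /F powRM ?mulr_ge0 ?powR_ge0//.
  rewrite powRM ?powR_ge0// -[in X in (_ * (_ * X))%R]powRrM mulVf// powRr1 ?ltW//.
  by rewrite indicE; case: (x \in B); rewrite /= ?powR1// powR0.
have E3 : 'N[mu]_q%:E[EFin \o G] `^ q =
    \int[mu]_(x in B) (w x `^ (1 / (1 - p)))%:E.
  rewrite (poweR_Lnorm _ _ qN0) ind; apply: eq_integral => x _.
  rewrite /= ger0_norm; last by rewrite !mulr_ge0// ?powR_ge0// indicE.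
  congr EFin; rewrite /G powRM ?powR_ge0//.
  rewrite -powRrM (_ : - p^-1 * q = 1 / (1 - p))%R; last first.
    by rewrite /q; field; rewrite p10 pN0 subr_eq0 lt_eqF.
  by rewrite indicE; case: (x \in B); rewrite /= ?powR1// powR0// gt_eqF.
rewrite -E2 -E3 -poweRrM (_ : q * (p - 1) = p)%R; last first.
  by rewrite /q; field; rewrite ?p10.
rewrite -poweRM ?Lnorm_ge0// -E1.
apply: gt0_ler_poweR => //; first exact: ltW.
  by rewrite in_itv/= leey integral_ge0.
by rewrite in_itv/= leey mule_ge0// Lnorm_ge0.
Qed.

End weighted_hoelder.

(** * Radii *)
Section dyadic_radii.
Context {R : realType}.

(** With radii rho / 2^k bounded by rho, a ball of maximal radius with a given
property exists: it has the least k. *)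
Definition rad (rho : R) (k : nat) : R := (rho / 2 ^+ k)%R.

Lemma rad_gt0 rho k : (0 < rho)%R -> (0 < rad rho k)%R.
Proof. by move=> rho0; rewrite divr_gt0// exprn_gt0. Qed.

Lemma rad_le rho k l : (0 < rho)%R -> (k <= l)%N -> (rad rho l <= rad rho k)%R.
Proof.
move=> rho0 kl; rewrite ler_pM2l// lef_pV2 ?posrE ?exprn_gt0//.
by rewrite ler_weXn2l// ler1n.
Qed.

Lemma rad0 rho : rad rho 0 = rho. Proof. by rewrite /rad expr0 divr1. Qed.

Lemma radS rho k : rad rho k = (2 * rad rho k.+1)%R.
Proof. by rewrite /rad exprS invfM; field; rewrite expf_neq0. Qed.

Lemma rad4 rho k : (4 * rad rho k = rad (4 * rho) k)%R.
Proof. by rewrite /rad mulrA. Qed.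

Lemma rad_small (rho e : R) : (0 < e)%R -> exists k, (rad rho k < e)%R.
Proof.
move=> e0; exists (Num.truncn (rho / e)).+1.
rewrite /rad ltr_pdivrMr ?exprn_gt0// mulrC -ltr_pdivrMr//.
apply: (lt_le_trans (truncnS_gt _)); rewrite -natrX ler_nat ltnW//.
exact: ltn_expl.
Qed.

End dyadic_radii.

(** * Powers, sums and lower limits *)
Section real_powers.
Context {R : realType}.
Local Open Scope ring_scope.

Lemma powRD_le (x y p : R) : 0 <= p -> 0 <= x -> 0 <= y ->
  (x + y) `^ p <= 2 `^ p * (x `^ p + y `^ p).
Proof.
move=> p0; wlog xy : x y / x <= y => [th|] x0 y0.
  have [xy|/ltW yx] := leP x y; first exact: th.
  by rewrite addrC [X in _ <= _ * X]addrC th.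
apply: (@le_trans _ _ ((2 * y) `^ p)).
  by apply: ge0_ler_powR => //; rewrite ?nnegrE ?addr_ge0 ?mulr_ge0//; lra.
by rewrite powRM// ler_wpM2l ?powR_ge0// lerDr powR_ge0.
Qed.

Lemma geometric_sum_le (a : R) n : 2 <= a ->
  \sum_(j < n) a ^+ j <= a ^+ n.
Proof.
move=> a2; elim: n => [|n IH]; first by rewrite big_ord0 expr0.
rewrite big_ord_recr/= exprS.
have : 0 <= a ^+ n by rewrite exprn_ge0//; lra.
nra.
Qed.

(** In a geometric sum the largest term dominates, so that up to a constant the
power of the sum is the sum of the powers, with a constant independent of the
number of terms. *)
Lemma powR_geometric_sum (a l p : R) (b : nat -> bool) n :
  2 <= a -> 0 <= l -> 0 < p ->
  (\sum_(j < n) (a ^+ j.+1 * l) * (b j)%:R) `^ p <=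
  2 `^ p * \sum_(j < n) (a ^+ j.+1 * l) `^ p * (b j)%:R.
Proof.
move=> a2 l0 p0.
have a0 : 0 <= a by lra.
have al j : 0 <= a ^+ j * l by rewrite mulr_ge0// exprn_ge0.
elim: n => [|n IH]; first by rewrite !big_ord0 mulr0 powR0 ?gt_eqF.
rewrite 2!big_ord_recr/=; case: (b n); last by rewrite !mulr0 !addr0.
rewrite !mulr1 mulrDr; apply: ler_wpDl.
  by rewrite mulr_ge0 ?powR_ge0// sumr_ge0// => j _; rewrite mulr_ge0// powR_ge0.
rewrite -powRM//; apply: ge0_ler_powR; rewrite ?nnegrE ?(ltW p0)//.
- by rewrite addr_ge0// sumr_ge0// => j _; rewrite mulr_ge0.
- by rewrite mulr_ge0.
apply: (@le_trans _ _ (\sum_(j < n.+1) a ^+ j.+1 * l)).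
  rewrite big_ord_recr/= lerD2r; apply: ler_sum => j _.
  by rewrite ler_piMr//; case: (b j).
rewrite -mulr_suml mulrA; apply: ler_wpM2r => //.
under eq_bigr do rewrite exprS.
rewrite -mulr_sumr big_ord_recr/=.
have := geometric_sum_le n a2; rewrite exprS.
have : 0 <= a ^+ n by rewrite exprn_ge0.
nra.
Qed.
End real_powers.

Section absorption.

Lemma sum_window_le (P : nat -> bool) N M : (0 < N)%N ->
  (forall i j, P i -> P j -> (i < j)%N -> (j - i < N)%N) ->
  (\sum_(m < M) P m <= N)%N.
Proof.
move=> N0 PN.
have -> : (\sum_(m < M) P m)%N = size [seq m <- index_iota 0 M | P m].
  by rewrite size_filter -sum1_count [RHS]big_mkcond/= big_mkord.
set s := [seq m <- _ | _ m].
have us : uniq s by rewrite filter_uniq// iota_uniq.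
have sP m : m \in s -> P m by rewrite mem_filter => /andP[].
have [->//|[i si]] : s = [::] \/ exists i, i \in s.
  by case: (s) => [|i s']; [left|right; exists i; exact: mem_head].
have ex : exists m, P m by exists i; exact: sP.
case: (ex_minnP ex) => m Pm minm.
rewrite -[leqRHS](size_iota m); apply: uniq_leq_size => // j /sP Pj.
rewrite mem_iota minm//=.
have := minm _ Pj; rewrite leq_eqVlt => /predU1P[<-|mj].
  by rewrite -[ltnLHS]addn0 ltn_add2l.
by have := PN _ _ Pm Pj mj; lia.
Qed.

Context {R : realType}.
Local Open Scope ring_scope.

(** The sums of the shifts of v are at most the sum of v, as v vanishes from M
on; the terms with v on the right can then be absorbed.  All values being real,
no question of finiteness arises. *)
Lemma absorb_shifted_sums (v b kappa : nat -> R) (D kap Q : R) n M :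
  0 <= D -> (forall m, 0 <= v m) -> (forall m, (M <= m)%N -> v m = 0) ->
  (forall j, (j < n)%N -> 0 <= kappa j <= kap) ->
  D * (kap * n%:R) <= 2^-1 ->
  (forall m, v m <= D * (\sum_(j < n) kappa j * v (m + j.+1)%N + b m)) ->
  \sum_(m < M) b m <= Q ->
  \sum_(m < M) v m <= 2 * D * Q.
Proof.
move=> D0 v0 vM kk Dn vb bQ; set V := \sum_(m < M) v m.
have V0 : 0 <= V by apply: sumr_ge0.
have shift j : \sum_(m < M) v (m + j)%N <= V.
  have -> : V = \sum_(0 <= m < M + j) v m.
    rewrite (big_cat_nat (leq0n M) (leq_addr _ _))/= big_mkord.
    rewrite [X in _ = _ + X]big1_seq ?addr0// => m /=.
    by rewrite mem_index_iota => /andP[Mm _]; rewrite vM.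
  rewrite (big_cat_nat (leq0n j) (leq_addl _ _))/= ler_wpDl ?sumr_ge0//.
  by rewrite -[X in index_iota X _]add0n big_addn addnK big_mkord.
have : V <= D * (kap * n%:R * V + Q).
  apply: (@le_trans _ _ (\sum_(m < M) D * (\sum_(j < n) kappa j * v (m + j.+1)%N + b m))).
    by apply: ler_sum => m _.
  rewrite -mulr_sumr ler_wpM2l// big_split/= lerD// exchange_big/=.
  apply: (@le_trans _ _ (\sum_(j < n) kap * V)).
    apply: ler_sum => j _; rewrite -mulr_sumr; have /andP[k0 k1] := kk _ (ltn_ord j).
    by apply: ler_pM => //; apply: sumr_ge0.
  by rewrite sumr_const card_ord -[leLHS]mulr_natr mulrAC.
move=> h; have : D * (kap * n%:R) * V <= 2^-1 * V by rewrite ler_wpM2r.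
move: h; rewrite mulrDr mulrA; lra.
Qed.
End absorption.

Section liminf.
Context {R : realType}.
Implicit Types (u : (\bar R)^nat) (a b : \bar R).

Lemma limn_einf_ge u a N : (forall n, (N <= n)%N -> a <= u n) ->
  a <= limn_einf u.
Proof.
move=> au; rewrite limn_einf_lim (cvg_lim _ (@cvg_einfs_sup _ u))//.
apply: (@le_trans _ _ (einfs u N)).
  by apply: le_ereal_inf_tmp => _ [n /= Nn <-]; exact: au.
by apply: ereal_sup_ubound; exists N.
Qed.

Lemma limn_einf_le u b : (forall n, u n <= b) -> limn_einf u <= b.
Proof.
move=> ub; rewrite limn_einf_lim (cvg_lim _ (@cvg_einfs_sup _ u))//.
apply: ge_ereal_sup => _ [n _ <-]; apply: le_trans (ub n).
by apply: ereal_inf_lbound; exists n => /=.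
Qed.

(** The power is continuous from the left, so that it is enough to know the
inequality for the reals below y, whether y is finite or not. *)
Lemma poweR_le_from_below (y B : \bar R) (a q : R) :
  (0 < q)%R -> (0 < a)%R -> 0 <= y -> 0 <= B ->
  (forall t : R, (0 < t)%R -> t%:E < y -> (t `^ q * a)%:E <= B) ->
  y `^ q * a%:E <= B.
Proof.
move=> q0 a0 y0 B0 h; case: B B0 h => [b b0 h| _ _|//]; last by rewrite leey.
rewrite leNgt; apply/negP => byq.
have qN0 : q != 0%R by rewrite gt_eqF.
rewrite lee_fin in b0.
have [u [u0 bu uy]] : exists u : R, [/\ (0 < u)%R, (b < u * a)%R & u%:E < y `^ q].
  case: y y0 byq {h} => [r r0 /=|_ _|//].
    rewrite -EFinM lte_fin => bq; exists ((b / a + r `^ q) / 2)%R.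
    have ba : (b / a < r `^ q)%R by rewrite ltr_pdivrMr.
    have b0' : (0 <= b / a)%R by rewrite divr_ge0// ltW.
    have rq : (0 < r `^ q)%R by exact: le_lt_trans ba.
    rewrite lte_fin; split; [lra| |lra].
    rewrite -ltr_pdivrMr//; lra.
  exists ((b + 1) / a)%R; split.
  - by rewrite divr_gt0//; lra.
  - by rewrite divfK ?gt_eqF//; lra.
  - by rewrite poweRyr// ltry.
have t0 : (0 < u `^ q^-1)%R by rewrite powR_gt0.
have tq : (u `^ q^-1 `^ q = u)%R by rewrite -powRrM mulVf// powRr1 ?ltW.
have ty : (u `^ q^-1)%:E < y.
  rewrite ltNge; apply/negP => yt; move: uy; rewrite ltNge => /negP; apply.
  rewrite -[in leRHS]tq -poweR_EFin; apply: gt0_ler_poweR => //.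
  - exact: ltW.
  - by rewrite in_itv/= leey y0.
  - by rewrite in_itv/= leey lee_fin ltW.
by have := h _ t0 ty; rewrite tq lee_fin leNgt bu.
Qed.

End liminf.

(** * Balls and coverings in a doubling space *)
Section doubling_space.
Context {R : realType} {d : measure_display} {X : metricMeasurableType R d}.
Variables (mu : {measure set X -> \bar R}) (c : R).
Hypothesis mu_borel : complete_borel_measure mu.
Hypothesis mu_ball : ball_measure_pos_finite mu.
Hypothesis c_gt1 : (1 < c)%R.
Hypothesis mu_doubling : doubling mu c.

Let c_gt0 : (0 < c)%R. Proof. exact: lt_trans c_gt1. Qed.

Lemma mdistC (x y : X) : mdist x y = mdist y x.
Proof. exact: metric_sym. Qed.

Lemma mdist_tri (x y z : X) : (mdist x z <= mdist x y + mdist y z)%R.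
Proof. exact: metric_triangle. Qed.

Lemma open_set_measurable (U : set X) : open U -> measurable U.
Proof.
move=> oU; apply/mu_borel; exists U, U; split => //.
- exact: sub_sigma_algebra.
- exact: sub_sigma_algebra.
- by rewrite setDv measure0.
Qed.

Lemma ball_is_open (x : X) (r : R) : open (ball x r).
Proof.
rewrite openE => y; rewrite ballEmdist/= => xy.
rewrite /interior -nbhs_ballE; exists (r - mdist x y)%R => /=.
  by rewrite subr_gt0.
move=> z; rewrite !ballEmdist/= => yz.
have := mdist_tri x y z; lra.
Qed.

Lemma ball_is_measurable (x : X) r : measurable (ball x r).
Proof. exact: open_set_measurable (ball_is_open x r). Qed.

Lemma sub_ball (x y : X) r s : (mdist x y + r <= s)%R -> ball y r `<=` ball x s.
Proof.
move=> xys z; rewrite !ballEmdist/= => yz.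
have := mdist_tri x y z; lra.
Qed.

Definition vol (x : X) (r : R) : R := fine (mu (ball x r)).

Lemma volE x r : (0 < r)%R -> mu (ball x r) = (vol x r)%:E.
Proof.
by move=> r0; rewrite /vol fineK// ge0_fin_numE//; have [] := mu_ball x r0.
Qed.

Lemma vol_gt0 x r : (0 < r)%R -> (0 < vol x r)%R.
Proof. by move=> r0; rewrite -lte_fin -volE//; have [] := mu_ball x r0. Qed.

Lemma vol_le x r y s : (0 < r)%R -> (0 < s)%R -> ball x r `<=` ball y s ->
  (vol x r <= vol y s)%R.
Proof.
move=> r0 s0 xy; rewrite -lee_fin -!volE//; apply: le_measure => //;
  exact/mem_set/ball_is_measurable.
Qed.

Lemma vol_double x r : (0 < r)%R -> (vol x (2 * r) <= c * vol x r)%R.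
Proof.
move=> r0; have := mu_doubling x r0.
by rewrite !volE ?mulr_gt0// -EFinM lee_fin.
Qed.

Lemma vol_quadruple x r : (0 < r)%R -> (vol x (4 * r) <= c ^+ 2 * vol x r)%R.
Proof.
move=> r0; have -> : (4 * r = 2 * (2 * r))%R by lra.
rewrite (le_trans (vol_double _ _)) ?mulr_gt0// expr2 -mulrA ler_pM2l ?vol_double//.
Qed.

(** The only covering argument of the proof.  Select disjoint balls such that
the fourfold ones cover E: a ball meeting a ball of at least the same radius is
contained in three times the latter.  Summing the inequalities over the
selected balls, which are disjoint and contained in V, gives the claim.  The
selected family is countable since disjoint balls have positive measure. *)
Lemma covering_comparison (rho : R) (g1 g2 : X -> \bar R) (E V : set X)
    (K : R) :
  (0 < rho)%R -> (0 <= K)%R ->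
  measurable_fun setT g1 -> measurable_fun setT g2 ->
  (forall x, 0 <= g1 x) -> (forall x, 0 <= g2 x) ->
  measurable E -> measurable V ->
  (forall x, E x -> exists z k,
    [/\ ball z (rad rho k) x, ball z (rad rho k) `<=` V &
      \int[mu]_(y in ball z (4 * rad rho k)%R) g1 y <=
      K%:E * \int[mu]_(y in ball z (rad rho k)) g2 y]) ->
  \int[mu]_(x in E) g1 x <= K%:E * \int[mu]_(x in V) g2 x.
Proof.
move=> rho0 K0 mg1 mg2 g10 g20 mE mV EV.
have rpos k := rad_gt0 k rho0.
have radS k l := rad_le (k := k) (l := l) rho0.
pose B (p : X * nat) := ball p.1 (rad rho p.2).
pose B4 (p : X * nat) := ball p.1 (4 * rad rho p.2)%R.
pose Fam := [set p : X * nat | B p `<=` V /\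
  \int[mu]_(y in B4 p) g1 y <= K%:E * \int[mu]_(y in B p) g2 y].
have B0 p : B p !=set0 by exists p.1; exact: ballxx.
have [D [DF tD DV]] := ranked_vitali snd Fam B0.
have cD : countable D.
  have [[x0 _]|noX] := pselect (exists x : X, True); last first.
    have -> : D = set0 by apply/seteqP; split => // p; case: noX; exists p.1.
    exact: finite_set_countable.
  have -> : D = \bigcup_n (D `&` [set p | mdist x0 p.1 <= n%:R]%R).
    apply/seteqP; split => [p Dp|p [n _ []]//].
    exists (Num.truncn (mdist x0 p.1)).+1 => //; split => //=.
    by rewrite ltW// truncnS_gt.
  apply: bigcup_countable => // n _.
  have nr0 : (0 < n%:R + rho)%R by rewrite ltr_wpDl.
  apply: (@countable_disjoint_pos _ _ _ mu _ _ B (ball x0 (n%:R + rho)%R)).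
  - exact: ball_is_measurable.
  - by have [] := mu_ball x0 nr0.
  - move=> p [Dp pn]; split; first exact: ball_is_measurable.
      apply: sub_ball; apply: lerD => //.
      by apply: le_trans (radS 0%N _ _) _ => //; rewrite rad0.
    by have [] := mu_ball p.1 (rpos p.2).
  - by apply: sub_trivIset tD => p [].
have /countable_injP[g ginj] := cD.
pose F k := \bigcup_(p in D `&` [set p | g p = k]) B p.
pose G k := \bigcup_(p in D `&` [set p | g p = k]) B4 p.
have FGE k : (exists2 p, D p & F k = B p /\ G k = B4 p) \/
    (F k = set0 /\ G k = set0).
  have [[p [Dp gp]]|np] := pselect (exists p, D p /\ g p = k).
    left; exists p => //; rewrite /F /G.
    have -> : D `&` [set p | g p = k] = [set p].
      apply/seteqP; split => [q [Dq gq]|q ->//].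
      by apply: ginj; [exact/mem_set|exact/mem_set|rewrite gq].
    by rewrite !bigcup_set1.
  right; rewrite /F /G.
  have -> : D `&` [set p | g p = k] = set0.
    by apply/seteqP; split => // q [Dq gq]; apply: np; exists q.
  by rewrite !bigcup_set0.
have mF k : measurable (F k).
  by have [[p _ [-> _]]|[-> _]] := FGE k => //; exact: ball_is_measurable.
have mG k : measurable (G k).
  by have [[p _ [_ ->]]|[_ ->]] := FGE k => //; exact: ball_is_measurable.
have tF : trivIset setT F.
  move=> i j _ _ [x [[p [Dp gp] px] [q [Dq gq] qx]]].
  suff pq : p = q by rewrite -gp -gq pq.
  by apply: tD => //; exists x.
have EG : E `<=` \bigcup_k G k.
  move=> x Ex; have [z [k [zx zV zK]]] := EV x Ex.
  have [p [Dp pk [y [zy py]]]] := DV (z, k) (conj zV zK).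
  exists (g p) => //; exists p => //; rewrite /B4.
  move: zx zy py; rewrite /B/= !ballEmdist/= => zx zy py.
  have := radS _ _ pk; have := rpos p.2.
  have := mdist_tri p.1 y x; have := mdist_tri y z x.
  rewrite (mdistC y z) /=; lra.
have FV : \bigcup_k F k `<=` V.
  by apply: bigcup_sub => k _; apply: bigcup_sub => p [/DF[]].
apply: (@le_trans _ _ (\int[mu]_(x in \bigcup_k G k) g1 x)).
  apply: ge0_subset_integral => //; first exact: bigcup_measurable.
  exact: measurable_funTS.
apply: (le_trans (ge0_integral_bigcup_le _ _ _ _)) => //.
apply: (@le_trans _ _ (K%:E * \int[mu]_(x in \bigcup_k F k) g2 x)); last first.
  rewrite lee_wpmul2l ?lee_fin//; apply: ge0_subset_integral => //.
    exact: bigcup_measurable.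
  exact: measurable_funTS.
rewrite ge0_integral_bigcup//; last exact: measurable_funTS.
rewrite -nneseriesZl; last by move=> i _; exact: integral_ge0.
apply: lee_nneseries => [i _ _|i _]; first exact: integral_ge0.
have [[p /DF[_ Kp] [-> ->]]//|[-> ->]] := FGE i.
by rewrite !integral_set0 mule0.
Qed.

(** * Outer regularity *)
Lemma decreasing_measure_lt (F : (set X)^nat) (e : \bar R) :
  mu (F 0%N) < +oo -> (forall i, measurable (F i)) ->
  nonincreasing_seq F -> mu (\bigcap_n F n) < e -> exists n, mu (F n) < e.
Proof.
move=> F0 mF niF Fe.
have niu : nonincreasing_seq (mu \o F).
  move=> m n mn; apply: le_measure; [exact/mem_set|exact/mem_set|].
  exact/subsetPset/niF.
have := nonincreasing_cvg_mu F0 mF (bigcapT_measurable mF) niF.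
move=> /(cvg_unique _ (ereal_nonincreasing_cvgn niu)) => /(_ (@ereal_hausdorff _)).
move=> E; move: Fe; rewrite -E => /ereal_inf_lt[_ [n _ <-] ne].
by exists n.
Qed.

(** The complement of V plays the role of a closed set approximating A from
inside; stated with two open sets, the property is symmetric under
complementation. *)
Definition separable_by_open (S A : set X) := forall e : R, (0 < e)%R ->
  exists U V, [/\ open U, open V, A `<=` U, ~` A `<=` V &
    mu (S `&` (U `&` V)) < e%:E].

(** The separable sets form a sigma-algebra containing the open sets.  For a
union of sets A_i, the complement is enclosed in the intersection of the
first n of the sets V_i, which is open, and n is chosen by continuity of the
measure; for an open A, in the 1/(n+1)-neighbourhood of its complement. *)
Lemma borel_separable_by_open (S : set X) : measurable S -> mu S < +oo ->
  <<s open >> `<=` separable_by_open S.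
Proof.
move=> mS Soo; apply: smallest_sub; first split.
- move=> e e0; exists set0, setT; split => //; [exact: open0|exact: openT|].
  by rewrite set0I setI0 measure0.
- move=> A sA e /sA[U [V [oU oV AU AV UVe]]]; exists V, U; split => //.
    by rewrite setTD.
    by rewrite setTD setCK.
  by rewrite (setIC V).
- move=> A sA e e0.
  have e20 n : (0 < e / 2 / (2 ^ n.+1)%:R)%R.
    by rewrite !divr_gt0// ltr0n expn_gt0.
  have /choice[U] := fun n => sA n _ (e20 n).
  move=> /choice[V] UV.
  pose W n := \bigcap_(i < n) V i.
  have oW n : open (W n).
    rewrite /W bigcap_mkord; elim/big_ind : _ => [| |i _]; first exact: openT.
      exact: openI.
    by have [] := UV i.
  have oU : open (\bigcup_n U n) by apply: bigcup_open => n _; have [] := UV n.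
  have [n Wn] : exists n, mu (S `&` (\bigcup_n U n `&` W n)) < e%:E.
    apply: decreasing_measure_lt.
    + apply: le_lt_trans Soo; apply: le_measure; [|exact/mem_set|by move=> x []].
      apply/mem_set/measurableI => //; apply: open_set_measurable.
      exact: openI.
    + move=> n; apply: measurableI => //; apply: open_set_measurable.
      exact: openI.
    + move=> m n mn; apply/subsetPset; apply: setIS; apply: setIS.
      by move=> x Wx i im; apply: Wx; exact: leq_trans mn.
    + have mUV n : measurable (S `&` (U n `&` V n)).
        have [oU1 oV1 _ _ _] := UV n.
        by apply: measurableI => //; apply: open_set_measurable; exact: openI.
      have mW : measurable (\bigcap_n (S `&` (\bigcup_k U k `&` W n))).
        apply: bigcap_measurable => // n _; apply: measurableI => //.
        by apply: open_set_measurable; exact: openI.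
      apply: (@le_lt_trans _ _ (\sum_(n <oo) mu (S `&` (U n `&` V n)))).
        apply: measure_sigma_subadditive => // x Wx.
        have [Sx [[i _ Ui] _]] := Wx 0%N I.
        exists i => //; split => //; split => //.
        by have [_ [_ Wi]] := Wx i.+1 I; apply: Wi => /=.
      apply: (@le_lt_trans _ _ (e / 2)%:E); last by rewrite lte_fin; lra.
      apply: le_trans (epsilon_trick0 xpredT _); last by lra.
      apply: lee_nneseries => [n _ _|n _]; first exact: measure_ge0.
      by apply: ltW; have [] := UV n.
  exists (\bigcup_n U n), (W n); split => //.
  + by apply: subset_bigcup => i _; have [] := UV i.
  + rewrite setC_bigcup => x Ax i _; have [_ _ _ + _] := UV i; apply.
    exact: Ax.
- move=> A oA e e0.
  pose V n := \bigcup_(y in ~` A) ball y (n.+1%:R^-1 : R)%R.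
  have oV n : open (V n).
    apply: bigcup_open => y _; exact: (ball_is_open).
  have mA : measurable A by exact: open_set_measurable.
  have mV n : measurable (V n) by exact: open_set_measurable.
  have [n Vn] : exists n, mu (S `&` (A `&` V n)) < e%:E.
    apply: decreasing_measure_lt.
    + apply: le_lt_trans Soo; apply: le_measure; [|exact/mem_set|by move=> x []].
      by apply/mem_set; do 2 apply: measurableI => //.
    + by move=> n; do 2 apply: measurableI => //.
    + move=> m n mn; apply/subsetPset; apply: setIS; apply: setIS.
      apply: subset_bigcup => y _; apply: le_ball.
      by rewrite lef_pV2 ?posrE// ler_nat.
    + rewrite (_ : \bigcap_n _ = set0) ?measure0//.
      apply/seteqP; split => // x Hx; have [_ [Ax _]] := Hx 0%N I.
      have : nbhs x A by exact: open_nbhs_nbhs.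
      rewrite -nbhs_ballE => -[r r0 rA].
      have [n _ /(_ n (leqnn n)) /= nr] := near_infty_natSinv_lt (PosNum r0).
      have [_ [_ [y Ay yx]]] := Hx n I; apply: Ay; apply: rA.
      by apply: ball_sym; apply: le_ball yx; exact: ltW.
  exists A, (V n); split => // y Ay; exists y => //.
  by apply: ballxx; rewrite invr_gt0.
Qed.

Lemma outer_regular (S A : set X) (e : R) : measurable S -> mu S < +oo ->
  measurable A -> A `<=` S -> (0 < e)%R ->
  exists V, [/\ open V, A `<=` V & mu (V `&` S) <= mu A + e%:E].
Proof.
move=> mS Soo mA AS e0.
have [B1 [B2 [b1 b2 B1A AB2 B120]]] := (mu_borel A).1 mA.
have mB2 : measurable B2.
  by apply/mu_borel; exists B2, B2; split => //; rewrite setDv measure0.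
have mB1 : measurable B1.
  by apply/mu_borel; exists B1, B1; split => //; rewrite setDv measure0.
have [U [V [oU oV BU BV UV]]] := borel_separable_by_open mS Soo b2 e0.
exists U; split => //; first exact: subset_trans BU.
have mU := open_set_measurable oU.
have mV := open_set_measurable oV.
have mUV : measurable (S `&` (U `&` V)) by do 2 apply: measurableI => //.
apply: (@le_trans _ _ (mu (A `|` ((B2 `\` B1) `|` (S `&` (U `&` V)))))).
  apply: le_measure; [apply/mem_set|apply/mem_set|].
  - exact: measurableI.
  - by apply: measurableU => //; apply: measurableU => //; exact: measurableD.
  - move=> x [Ux Sx]; have [Ax|nAx] := pselect (A x); first by left.
    right; have [B2x|nB2x] := pselect (B2 x).
      by left; split => // /B1A.
    by right; split => //; split => //; exact: BV.
apply: le_trans (measureU2 _ _ _) _ => //.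
  by apply: measurableU => //; exact: measurableD.
rewrite leeD2l//; apply: le_trans (measureU2 _ _ _) _ => //.
  exact: measurableD.
by rewrite [X in X + _](B120 : _ = 0) add0e ltW.
Qed.

(** * Superlevel sets of the maximal function *)

(** The set where the maximal function over balls of radius rho / 2^k exceeds l.
Being a union of balls it is open; averages are written without division. *)
Definition superlevel (rho : R) (f : X -> R) (l : R) : set X :=
  [set x | exists z k, ball z (rad rho k) x /\
    (l * vol z (rad rho k))%:E < \int[mu]_(y in ball z (rad rho k)) (f y)%:E].

Lemma superlevel_open rho f l : open (superlevel rho f l).
Proof.
rewrite (_ : superlevel _ _ _ = \bigcup_(p in [set p : X * nat |
    (l * vol p.1 (rad rho p.2))%:E <
    \int[mu]_(y in ball p.1 (rad rho p.2)) (f y)%:E])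
    ball p.1 (rad rho p.2)).
  by apply: bigcup_open => p _; exact: ball_is_open.
apply/seteqP; split => [x [z [k [zx h]]]|x [[z k]/= h zx]].
  by exists (z, k).
by exists z, k.
Qed.

Lemma superlevel_measurable rho f l : measurable (superlevel rho f l).
Proof. exact: (open_set_measurable (superlevel_open rho f l)). Qed.

Lemma superlevel_le rho f l l' : (0 < rho)%R -> (l <= l')%R ->
  superlevel rho f l' `<=` superlevel rho f l.
Proof.
move=> rho0 ll x [z [k [zx h]]]; exists z, k; split => //.
by apply: le_lt_trans h; rewrite lee_fin ler_wpM2r// ltW// vol_gt0// rad_gt0.
Qed.

Lemma integral1_ball z r : (0 < r)%R -> \int[mu]_(y in ball z r) 1 = (vol z r)%:E.
Proof.
move=> r0; rewrite -volE// (_ : (fun=> 1) = cst 1)// integral_cst ?mul1e//.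
exact: ball_is_measurable.
Qed.

(** A weak form of the differentiation theorem.  Let E be the set in question
and V an open set containing it, of almost the same measure.  At a point of E
all averages are at most l, so that the integral of f over E is at most
c^2 l mu(V) by the covering argument, while it is at least 2 c^2 l mu(E). *)
Lemma le_superlevel_ae (rho : R) (f : X -> R) (l : R) :
  (0 < rho)%R -> (0 < l)%R ->
  (forall x, (0 <= f x)%R) -> measurable_fun setT f ->
  mu ([set x | (2 * c ^+ 2 * l < f x)%R] `\` superlevel rho f l) = 0.
Proof.
move=> rho0 l0 f0 mf.
set E := _ `\` _.
have c0 := c_gt0.
have mE : measurable E.
  apply: measurableD; last exact: superlevel_measurable.
  exact: measurable_gt_set.
have [[x0 _]|noX] := pselect (exists x : X, True); last first.
  have -> : E = set0 by apply/seteqP; split => // x; case: noX; exists x.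
  by rewrite measure0.
pose S n := ball x0 (n.+1%:R : R)%R.
have Sfin n : mu (S n) < +oo by have [] := mu_ball x0 (ltr0Sn R n).
have mES n : measurable (E `&` S n) by apply: measurableI => //; exact: ball_is_measurable.
suff ES0 n : mu (E `&` S n) = 0.
  apply/eqP; rewrite eq_le measure_ge0 andbT.
  apply: (@le_trans _ _ (\sum_(n <oo) mu (E `&` S n))); last first.
    by rewrite eseries0.
  apply: measure_sigma_subadditive => // x Ex.
  exists (Num.truncn (mdist x0 x)) => //; split => //.
  by rewrite /S ballEmdist/= truncnS_gt.
apply/eqP; rewrite eq_le measure_ge0 andbT; apply/lee_addgt0Pr => e e0.
have ESfin : mu (E `&` S n) \is a fin_num.
  rewrite ge0_fin_numE//; apply: le_lt_trans (Sfin n); apply: le_measure.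
  - exact/mem_set.
  - exact/mem_set/ball_is_measurable.
  - by move=> x [].
have [V [oV EV VS]] := outer_regular (ball_is_measurable x0 _) (Sfin n)
  (mES n) (@subIsetr _ _ _) e0.
have mf' : measurable_fun setT (EFin \o f) by exact/measurable_EFinP.
have mVS : measurable (V `&` S n).
  by apply: measurableI; [exact: open_set_measurable|exact: ball_is_measurable].
have main : \int[mu]_(x in E `&` S n) (f x)%:E <=
    (l * c ^+ 2)%:E * \int[mu]_(x in V `&` S n) 1.
  apply: (@covering_comparison (rho / 4)%R
    (EFin \o f) (cst 1)) => //.
  - by rewrite divr_gt0.
  - by rewrite mulr_ge0// ?exprn_ge0// ltW.
  - move=> x Ex; have [[fx nU] Sx] := Ex.
    have oVS : open (V `&` S n) by apply: openI => //; exact: ball_is_open.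
    have : nbhs x (V `&` S n) by apply: open_nbhs_nbhs; split => //; split => //; exact: EV.
    rewrite -nbhs_ballE => -[r r0 rV].
    have [k kr] := rad_small (rho / 4)%R r0.
    have k0 : (0 < rad (rho / 4) k)%R by rewrite rad_gt0// divr_gt0.
    exists x, k; split.
    + exact: ballxx.
    + by apply: subset_trans rV; apply: le_ball; exact: ltW.
    + rewrite integral1_ball// -EFinM rad4 mulrCA mulfV ?mulr1//.
      rewrite leNgt; apply/negP => h; apply: nU; exists x, k; split.
        by apply: ballxx; exact: rad_gt0.
      apply: le_lt_trans h; rewrite lee_fin -mulrA ler_pM2l//.
      have -> : (rad rho k = 4 * rad (rho / 4) k)%R.
        by rewrite rad4 mulrCA mulfV ?mulr1.
      exact: vol_quadruple.
have low : (2 * c ^+ 2 * l)%:E * mu (E `&` S n) <= \int[mu]_(x in E `&` S n) (f x)%:E.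
  rewrite -integral_cst//; apply: ge0_le_integral => //.
  - by move=> x _; rewrite lee_fin !mulr_ge0// ?exprn_ge0// ltW.
  - exact: measurable_funTS.
  - by move=> x [[/= fx _] _]; rewrite lee_fin ltW.
have := le_trans low main.
rewrite (_ : (fun=> 1) = cst 1)// integral_cst// mul1e => /le_trans h.
have {h} := h _ (lee_wpmul2l _ VS).
rewrite lee_fin => /(_ (mulr_ge0 (ltW l0) (exprn_ge0 2 (ltW c0)))).
rewrite -(fineK ESfin) -EFinD -!EFinM !lee_fin add0r => h.
have lc0 : (0 < l * c ^+ 2)%R by rewrite mulr_gt0// exprn_gt0.
rewrite -(ler_pM2l lc0); move: h; lra.
Qed.

(** * The weak type inequality *)
Lemma muckenhoupt_hoelder (p A : R) (w g : X -> R) (z : X) (r : R) :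
  (1 < p)%R -> (0 < r)%R -> measurable_fun setT w -> (forall x, (0 < w x)%R) ->
  Muckenhoupt_bound mu p w A ->
  measurable_fun setT g -> (forall x, (0 <= g x)%R) ->
  (\int[mu]_(x in ball z r) (g x)%:E) `^ p *
    \int[mu]_(x in ball z r) (w x)%:E <=
  (A * vol z r `^ p)%:E * \int[mu]_(x in ball z r) (g x `^ p * w x)%:E.
Proof.
move=> p1 r0 mw w0 Aw mg g0.
have v0 : (0 < vol z r)%R by exact: vol_gt0.
have v1 : (0 < (vol z r)^-1)%R by rewrite invr_gt0.
have p10 : (0 < p - 1)%R by lra.
have [v0' v1'] := (ltW v0, ltW v1).
have := Aw z r r0; rewrite /average volE// inver gt_eqF//.
have mB : measurable (ball z r) by exact: ball_is_measurable.
set W := \int[mu]_(x in _) (w x)%:E; set S := \int[mu]_(x in _) (_ `^ _)%:E.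
set I := \int[mu]_(x in _) (_ * _)%:E; set G := \int[mu]_(x in _) (g x)%:E.
have W0 : 0 <= W by apply: integral_ge0 => x _; rewrite lee_fin ltW.
have S0 : 0 <= S by apply: integral_ge0 => x _; rewrite lee_fin powR_ge0.
have I0 : 0 <= I by apply: integral_ge0 => x _; rewrite lee_fin mulr_ge0// ?powR_ge0// ltW.
move=> H.
have HWS : W * S `^ (p - 1) <= (A * vol z r `^ p)%:E.
  rewrite poweRM// in H.
  rewrite muleACA poweR_EFin -EFinM in H.
  rewrite -(@lee_pmul2l _ ((vol z r)^-1 * (vol z r)^-1 `^ (p - 1))%:E)//; last first.
    by rewrite lte_fin mulr_gt0// powR_gt0.
  apply: le_trans H _; rewrite -EFinM lee_fin.
  have -> : ((vol z r)^-1 * (vol z r)^-1 `^ (p - 1) = (vol z r)^-1 `^ p)%R.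
    rewrite -[X in (X * _)%R](powRr1 v1') -powRD; last by rewrite (gt_eqF v1) implybT.
    by rewrite addrC subrK.
  by rewrite mulrCA -powRM// mulVf ?gt_eqF// powR1 mulr1.
have h := weighted_hoelder mu p1 mB mw w0 mg g0.
apply: (@le_trans _ _ (I * S `^ (p - 1) * W)).
  exact: lee_wpmul2r.
by rewrite -muleA muleC; apply: lee_wpmul2r => //; rewrite muleC.
Qed.

(** The A_p condition on the fourfold ball, applied to g restricted to the ball,
compares the weight of the fourfold ball with the integral of g^p w over the
ball itself; it remains to apply the covering argument. *)
Lemma muckenhoupt_weak_type (p A : R) (w g : X -> R) (E : set X) (rho t : R) :
  (1 < p)%R -> (0 < rho)%R -> (0 < t)%R -> (0 <= A)%R ->
  measurable_fun setT w -> (forall x, (0 < w x)%R) ->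
  Muckenhoupt_bound mu p w A ->
  measurable_fun setT g -> (forall x, (0 <= g x)%R) -> measurable E ->
  (forall x, E x -> exists z k, ball z (rad rho k) x /\
    (t * vol z (rad rho k))%:E <= \int[mu]_(y in ball z (rad rho k)) (g y)%:E) ->
  (t `^ p)%:E * \int[mu]_(x in E) (w x)%:E <=
  (A * (c ^+ 2) `^ p)%:E * \int[mu]_x (g x `^ p * w x)%:E.
Proof.
move=> p1 rho0 t0 A0 mw w0 Aw mg g0 mE HE.
have tp0 : (0 < t `^ p)%R by rewrite powR_gt0.
have c0 := c_gt0.
have mgw : measurable_fun setT (fun x => (g x `^ p * w x)%:E).
  apply/measurable_EFinP; apply: measurable_funM => //.
  exact: (measurableT_comp (measurable_powR _) mg).
rewrite -(@lee_pmul2l _ (t `^ p)^-1%:E) ?lte_fin ?invr_gt0// !muleA -!EFinM.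
rewrite mulVf ?gt_eqF// mul1e.
apply: (covering_comparison rho0) => //.
- by rewrite !mulr_ge0// ?invr_ge0 ?powR_ge0.
- exact/measurable_EFinP.
- by move=> x; rewrite lee_fin ltW.
- by move=> x; rewrite lee_fin mulr_ge0// ?powR_ge0// ltW.
move=> x Ex; have [z [k [zx zg]]] := HE _ Ex.
exists z, k; split => //; set r := rad rho k in zx zg *.
have r0 : (0 < r)%R by exact: rad_gt0.
have v0 : (0 < vol z r)%R by exact: vol_gt0.
have mB : measurable (ball z r) by exact: ball_is_measurable.
pose g' y := (\1_(ball z r) y * g y)%R.
have mg' : measurable_fun setT g' by apply: measurable_funM => //; exact: measurable_indic.
have g'0 y : (0 <= g' y)%R by rewrite mulr_ge0.
have r40 : (0 < 4 * r)%R by lra.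
have BB : ball z r `<=` ball z (4 * r)%R by apply: le_ball; lra.
have sub (h : X -> R) : \int[mu]_(y in ball z (4 * r)%R) (\1_(ball z r) y * h y)%:E
    = \int[mu]_(y in ball z r) (h y)%:E.
  rewrite [RHS]integral_mkcond [LHS]integral_mkcond; apply: eq_integral => y _.
  rewrite /patch indicE; case: ifPn => [_|]; case: ifPn => //.
  - by rewrite mul1r.
  - by rewrite mul0r.
  - by move=> /set_mem/BB/mem_set -> .
have := muckenhoupt_hoelder z p1 r40 mw w0 Aw mg' g'0.
rewrite sub.
have -> : \int[mu]_(y in ball z (4 * r)%R) (g' y `^ p * w y)%:E =
    \int[mu]_(y in ball z r) (g y `^ p * w y)%:E.
  rewrite -sub; apply: eq_integral => y _; congr EFin; rewrite mulrA.
  congr (_ * _)%R; rewrite /g' indicE; case: (_ \in _); rewrite /= ?mul1r// !mul0r powR0// gt_eqF//; lra.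
set J := \int[mu]_(y in ball z r) (_ * _)%:E; set W := \int[mu]_(y in _) (w y)%:E => H.
have W0 : 0 <= W by apply: integral_ge0 => y _; rewrite lee_fin ltW.
have J0 : 0 <= J by apply: integral_ge0 => y _; rewrite lee_fin mulr_ge0 ?powR_ge0// ltW.
rewrite -(@lee_pmul2l _ ((t * vol z r) `^ p)%:E) ?lte_fin ?powR_gt0 ?mulr_gt0//.
apply: (@le_trans _ _ ((\int[mu]_(y in ball z r) (g y)%:E) `^ p * W)).
  apply: lee_wpmul2r => //; rewrite -poweR_EFin; apply: gt0_ler_poweR => //.
  - lra.
  - by rewrite in_itv/= leey lee_fin mulr_ge0// ltW.
  - by rewrite in_itv/= leey integral_ge0// => y _; rewrite lee_fin.
apply: (le_trans H); rewrite muleA -EFinM; apply: lee_wpmul2r => //.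
have v40 : (0 < vol z (4 * r))%R by exact: vol_gt0.
have [[v0' t0'] v40'] := (ltW v0, ltW t0, ltW v40).
rewrite lee_fin powRM//.
rewrite [leRHS](_ : _ = A * ((c ^+ 2) `^ p * vol z r `^ p))%R; last first.
  by field; rewrite gt_eqF.
rewrite ler_wpM2l// -powRM ?exprn_ge0 ?(ltW c0)//.
apply: ge0_ler_powR; rewrite ?nnegrE ?mulr_ge0 ?exprn_ge0 ?(ltW c0)//.
- lra.
- exact: vol_quadruple.
Qed.

(** * Truncation at the superlevel sets *)
Lemma vol_pow2 x r n : (0 < r)%R -> (vol x (2 ^+ n * r) <= c ^+ n * vol x r)%R.
Proof.
move=> r0; elim: n => [|n IH]; first by rewrite !expr0 !mul1r.
rewrite !exprS -!mulrA (le_trans (vol_double _ _))//.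
  by rewrite mulr_gt0// exprn_gt0.
by rewrite ler_pM2l.
Qed.

Lemma superlevel_ball rho f l z k :
  (l * vol z (rad rho k))%:E < \int[mu]_(y in ball z (rad rho k)) (f y)%:E ->
  ball z (rad rho k) `<=` superlevel rho f l.
Proof. by move=> h x zx; exists z, k. Qed.

(** The stopping ball at x: a ball through x of largest radius with average
greater than l. *)
Lemma superlevel_largest rho f l x : superlevel rho f l x ->
  exists z k, [/\ ball z (rad rho k) x,
    (l * vol z (rad rho k))%:E < \int[mu]_(y in ball z (rad rho k)) (f y)%:E &
    forall z' k', (k' < k)%N -> ball z' (rad rho k') x ->
      \int[mu]_(y in ball z' (rad rho k')) (f y)%:E <=
      (l * vol z' (rad rho k'))%:E].
Proof.
move=> [z [k [zx h]]].
pose Q k := `[< exists z, ball z (rad rho k) x /\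
  (l * vol z (rad rho k))%:E < \int[mu]_(y in ball z (rad rho k)) (f y)%:E >].
have exQ : exists k, Q k by exists k; apply/asboolP; exists z.
case: (ex_minnP exQ) => m /asboolP[y [yx hy]] minm.
exists y, m; split => // z' k' k'm z'x; rewrite leNgt; apply/negP => h'.
have /minm : Q k' by apply/asboolP; exists z'.
by rewrite leqNgt k'm.
Qed.

(** Besides replacing f by L on its superlevel set, small values of f are
discarded, so that later only points with l/2 < f enter; this costs at most
half of an average greater than l. *)
Definition truncation rho f l L : X -> R := fun y =>
  (L * \1_(superlevel rho f L) y +
   \1_(~` superlevel rho f L `&` [set x | (l / 2 < f x)%R]) y * f y)%R.

Lemma truncation_ge0 rho f l L y : (0 <= L)%R -> (forall x, (0 <= f x)%R) ->
  (0 <= truncation rho f l L y)%R.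
Proof. by move=> L0 f0; rewrite addr_ge0// mulr_ge0. Qed.

Lemma truncation_measurable rho f l L : measurable_fun setT f ->
  measurable_fun setT (truncation rho f l L).
Proof.
move=> mf; have mU := superlevel_measurable rho f L.
apply: measurable_funD; apply: measurable_funM => //.
apply: measurable_indic; apply: measurableI; first exact: measurableC.
exact: measurable_gt_set.
Qed.

Definition average_const : R := (2 * (1 + c ^+ 2) * c ^+ 4)^-1%R.

Let average_const_gt0 : (0 < average_const)%R.
Proof. by rewrite invr_gt0 !mulr_gt0 ?exprn_gt0// addr_gt0// exprn_gt0. Qed.

(** Let B be a stopping ball at x for the level l, and cover the part of U(L) in
B by stopping balls for the level L.  As L >= c l, these are not larger than B,
unless their radius is comparable to rho: otherwise a ball through x of twice
their radius would contradict the choice of B.  On their fourfold enlargements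
the average of f is at most L, so that the integral of f over B inside U(L) is
at most a multiple of the integral of L over a part of U(L) near B.  The second
alternative is the case of a covering ball of radius at least rho/2, whose
fourfold enlargement is not among the balls considered; but then U(L) contains
that ball, and the truncation has a large average on the ball of radius 4 rho.  The index k
does not depend on L, which allows to take means over L. *)
Lemma truncation_average (rho : R) (f : X -> R) (l : R) (x : X) :
  (0 < rho)%R -> (0 < l)%R -> (forall x, (0 <= f x)%R) ->
  measurable_fun setT f -> superlevel rho f l x ->
  exists k, forall L, (c * l <= L)%R ->
    (average_const * l * vol x (rad (4 * rho) k))%:E <=
      \int[mu]_(y in ball x (rad (4 * rho) k)) (truncation rho f l L y)%:E \/
    (average_const * l * vol x (rad (4 * rho) 0))%:E <=
      \int[mu]_(y in ball x (rad (4 * rho) 0)) (truncation rho f l L y)%:E.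
Proof.
move=> rho0 l0 f0 mf Ux.
have [z [k [zx zl maxk]]] := superlevel_largest Ux.
exists k => L clL.
have lL : (l <= L)%R by apply: le_trans clL; rewrite ler_peMl ?(ltW l0)// ltW.
have L0 : (0 < L)%R by exact: lt_le_trans lL.
set h := truncation rho f l L.
have h0 y : (0 <= h y)%R by apply: truncation_ge0 => //; exact: ltW.
have mh : measurable_fun setT h by exact: truncation_measurable.
have mh' : measurable_fun setT (EFin \o h) by exact/measurable_EFinP.
have mf' : measurable_fun setT (EFin \o f) by exact/measurable_EFinP.
have rho40 : (0 < 4 * rho)%R by rewrite mulr_gt0.
have rk0 := rad_gt0 k rho0.
have mB (y : X) (r : R) : measurable (ball y r) by exact: ball_is_measurable.
set U := superlevel rho f L.
have mU : measurable U by exact: superlevel_measurable.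
have hU y : U y -> h y = L.
  move=> Uy; rewrite /h /truncation !indicE mem_set// mulr1.
  by rewrite memNset ?mul0r ?addr0// => -[].
have hNU y : ~ U y -> (f y <= l / 2 + h y)%R.
  move=> nUy; rewrite /h /truncation !indicE memNset// mulr0 add0r.
  have [fl|fl] := ltP (l / 2)%R (f y).
    by rewrite mem_set// mul1r lerDr ltW// divr_gt0.
  by rewrite (le_trans fl)// lerDl mulr_ge0.
have tc0 : (0 < 2 * (1 + c ^+ 2) * c ^+ 4)%R.
  by rewrite !mulr_gt0 ?exprn_gt0// addr_gt0// exprn_gt0.
have [[y [[Uy zy] [z' [k' [z'y z'L k'1]]]]]|small] := pselect
   (exists y, (U `&` ball z (rad rho k)) y /\
     exists z' k', [/\ ball z' (rad rho k') y,
       (L * vol z' (rad rho k'))%:E < \int[mu]_(y in ball z' (rad rho k')) (f y)%:E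
       & (k' <= 1)%N]).
  right; set r := rad rho k' in z'y z'L *.
  have r0 : (0 < r)%R by exact: rad_gt0.
  have rrho : (r <= rho)%R.
    by have := rad_le rho0 (leq0n k'); rewrite rad0.
  have rhor : (rho <= 2 * r)%R.
    by have := rad_le rho0 k'1; have := radS rho 0; rewrite rad0 -/r; lra.
  have krho : (rad rho k <= rho)%R.
    by have := rad_le rho0 (leq0n k); rewrite rad0.
  rewrite rad0.
  have zx1 : (mdist z x < rad rho k)%R by move: zx; rewrite ballEmdist.
  have zy1 : (mdist z y < rad rho k)%R by move: zy; rewrite ballEmdist.
  have z'y1 : (mdist z' y < r)%R by move: z'y; rewrite ballEmdist.
  have dxz : (mdist x z' <= 2 * rho + r)%R.
    have := mdist_tri x z z'; have := mdist_tri z y z'.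
    rewrite (mdistC x z) (mdistC y z'); lra.
  have sub1 : ball z' r `<=` ball x (4 * rho)%R by apply: sub_ball; lra.
  have sub2 : ball x (4 * rho)%R `<=` ball z' (2 ^+ 4 * r)%R.
    by apply: sub_ball; rewrite mdistC; lra.
  apply: (@le_trans _ _ (\int[mu]_(y in ball z' r) (h y)%:E)); last first.
    exact: subset_integral_EFin.
  apply: (@le_trans _ _ (\int[mu]_(y in ball z' r) L%:E)); last first.
    apply: (@le_integral_EFin _ _ _ mu (cst L)) => //.
    - by move=> u; exact: ltW.
    - by move=> u zu; rewrite hU//; exact: (superlevel_ball z'L).
  rewrite integral_cst// volE// -EFinM lee_fin /average_const.
  have v1 : (vol x (4 * rho) <= c ^+ 4 * vol z' r)%R.
    apply: le_trans (vol_pow2 _ _ r0); apply: vol_le => //.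
    by rewrite mulr_gt0// exprn_gt0.
  rewrite -mulrA ler_pdivrMl//.
  apply: (@le_trans _ _ (L * (c ^+ 4 * vol z' r))%R).
    by apply: ler_pM => //; [exact: ltW|exact/ltW/vol_gt0].
  rewrite [leLHS](_ : _ = 1 * (c ^+ 4 * (L * vol z' r)))%R; last by ring.
  rewrite -[leRHS]mulrA ler_wpM2r// ?mulr_ge0 ?exprn_ge0 ?(ltW L0) ?(ltW c_gt0)//.
    exact/ltW/vol_gt0.
  have : (0 < c ^+ 2)%R by rewrite exprn_gt0.
  lra.
left; rewrite -rad4; set r := rad rho k.
have cover : \int[mu]_(y in U `&` ball z r) (f y)%:E <=
    (L * c ^+ 2)%:E * \int[mu]_(y in U `&` ball x (4 * r)%R) 1.
  apply: (@covering_comparison rho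
    (EFin \o f) (cst 1)) => //.
  - by rewrite mulr_ge0// ?exprn_ge0// ltW.
  - exact: measurableI.
  - exact: measurableI.
  move=> y Uzy; have [Uy zy] := Uzy.
  have [z' [[|[|k']] [z'y z'L maxk']]] := superlevel_largest Uy.
  - by exfalso; apply: small; exists y; split => //; exists z', 0%N.
  - by exfalso; apply: small; exists y; split => //; exists z', 1%N.
  have r'0 := rad_gt0 k'.+2 rho0.
  (* a larger covering ball, doubled, would contain x and beat the stopping ball *)
  have kk' : (k <= k'.+2)%N.
    rewrite leqNgt; apply/negP => k'k.
    have := rad_le rho0 k'k; rewrite -(ler_pM2l (ltr0Sn R 1)) -radS => rr.
    have z'x : ball z' (rad rho k'.+1) x.
      move: zx zy z'y; rewrite !ballEmdist/= => zx zy z'y.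
      have := mdist_tri z' y x; have := mdist_tri y z x.
      rewrite (mdistC y z) radS; move: rr; lra.
    have := maxk z' k'.+1 (ltnW k'k) z'x; apply/negP; rewrite -ltNge.
    apply: (@lt_le_trans _ _ (\int[mu]_(y in ball z' (rad rho k'.+2)) (f y)%:E)).
      apply: le_lt_trans z'L; rewrite lee_fin radS.
      apply: (@le_trans _ _ (l * (c * vol z' (rad rho k'.+2)))%R).
        by rewrite ler_pM2l// vol_double.
      by rewrite mulrA ler_wpM2r ?(mulrC l)//; exact/ltW/vol_gt0.
    apply: subset_integral_EFin => //.
    by apply: le_ball; exact: rad_le.
  have r'r : (rad rho k'.+2 <= r)%R by exact: rad_le.
  exists z', k'.+2; split => //.
  - move=> u z'u; split; first exact: (superlevel_ball z'L).
    move: zx zy z'y z'u; rewrite !ballEmdist/= -/r => zx zy z'y z'u.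
    have := mdist_tri x z u; have := mdist_tri z y u.
    have := mdist_tri y z' u.
    rewrite (mdistC x z) (mdistC y z'); lra.
  - rewrite integral1_ball// -EFinM.
    have -> : (4 * rad rho k'.+2 = rad rho k')%R by rewrite (radS rho k') (radS rho k'.+1); lra.
    apply: le_trans (maxk' z' k' _ _) _ => //.
      by apply: (le_ball _ z'y); apply: rad_le => //; rewrite -addn2 leq_addr.
    rewrite lee_fin -mulrA ler_pM2l//.
    have -> : (rad rho k' = 4 * rad rho k'.+2)%R by rewrite (radS rho k') (radS rho k'.+1); lra.
    exact: vol_quadruple.
have r0 : (0 < 4 * r)%R by rewrite mulr_gt0.
have zx1 : (mdist z x < r)%R by move: zx; rewrite ballEmdist.
set J := \int[mu]_(y in ball x (4 * r)%R) (h y)%:E.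
have J0 : 0 <= J by apply: integral_ge0 => y _; rewrite lee_fin.
have sub : ball z r `<=` ball x (4 * r)%R.
  by apply: sub_ball; rewrite mdistC; lra.
have up1 : (L * c ^+ 2)%:E * \int[mu]_(y in U `&` ball x (4 * r)%R) 1 <=
    (c ^+ 2)%:E * J.
  rewrite mulrC EFinM -muleA lee_wpmul2l ?lee_fin ?exprn_ge0 ?(ltW c_gt0)//.
  have mUB : measurable (U `&` ball x (4 * r)%R) by exact: measurableI.
  have -> : L%:E * \int[mu]_(y in U `&` ball x (4 * r)%R) 1 =
      \int[mu]_(y in U `&` ball x (4 * r)%R) L%:E.
    by rewrite (integral_cst mu mUB L%:E) (integral_cst mu mUB 1) mul1e.
  rewrite /J; apply: (@le_trans _ _ (\int[mu]_(y in U `&` ball x (4 * r)%R) (h y)%:E)).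
    apply: (@le_integral_EFin _ _ _ mu (cst L)) => //.
    - by move=> u; exact: ltW.
    - by move=> u [Uu _]; rewrite hU.
  by exact: subset_integral_EFin.
have up2 : \int[mu]_(y in ball z r `\` U) (f y)%:E <= (l / 2 * vol z r)%:E + J.
  apply: (@le_trans _ _ (\int[mu]_(y in ball z r `\` U) ((l / 2)%:E + (h y)%:E))).
    under [leRHS]eq_integral do rewrite -EFinD.
    apply: le_integral_EFin => //.
    - exact: measurableD.
    - exact: measurable_funD.
    - by move=> u [_ nUu]; exact: hNU.
  rewrite ge0_integralD//; last 4 first.
  - exact: measurableD.
  - by move=> u _; rewrite lee_fin ltW// divr_gt0.
  - by move=> u _; rewrite lee_fin.
  - exact: measurable_funTS.
  apply: leeD.
    rewrite integral_cst; last exact: measurableD.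
    rewrite [leRHS]EFinM -(volE z rk0) lee_wpmul2l ?lee_fin ?divr_ge0 ?(ltW l0)//.
    apply: le_measure; [exact/mem_set/measurableD|exact/mem_set|].
    by move=> u [].
  apply: subset_integral_EFin => //; first exact: measurableD.
  by move=> u [zu _]; exact: sub.
have key : (l * vol z r)%:E <= (c ^+ 2)%:E * J + ((l / 2 * vol z r)%:E + J).
  apply/ltW/(lt_le_trans zl).
  rewrite -(setUIDK (ball z r) U) ge0_integral_setU//; last 5 first.
  - exact: measurableI.
  - exact: measurableD.
  - exact: measurable_funTS.
  - by move=> u _; rewrite lee_fin.
  - by apply/disj_setPS => u [[_ Uu] [_]].
  by rewrite setIC leeD// (le_trans cover).
move: J0 key; rewrite -/J; move: (J) => [j| |]//; first last.
  by move=> _ _; rewrite leey.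
rewrite -EFinM -!EFinD !lee_fin => j0 key.
have v1 : (vol x (4 * r) <= c ^+ 4 * vol z r)%R.
  apply: le_trans (vol_pow2 _ _ rk0); apply: vol_le => //.
    by rewrite mulr_gt0// exprn_gt0.
  by apply: sub_ball; rewrite -/r; lra.
rewrite /average_const -mulrA ler_pdivrMl//.
apply: (@le_trans _ _ (l * (c ^+ 4 * vol z r))%R); first by rewrite ler_pM2l.
have c40 : (0 < c ^+ 4)%R by rewrite exprn_gt0.
rewrite [leLHS](_ : _ = c ^+ 4 * (l * vol z r))%R; last by ring.
rewrite [leRHS](_ : _ = c ^+ 4 * (2 * (1 + c ^+ 2) * j))%R; last by ring.
rewrite ler_pM2l//; move: key; lra.
Qed.

(** * The inequality between the levels *)

(** Large enough for three purposes: geometric sums are dominated by their last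
term, ratio * l >= c * l as required in [truncation_average], and
2 c^2 <= ratio, so that the loss in [le_superlevel_ae] is one step of the
progression of levels. *)
Definition ratio : R := (4 * c ^+ 2)%R.

Let ratio_ge4 : (4 <= ratio)%R.
Proof. by rewrite /ratio ler_peMr// exprn_ege1// ltW. Qed.

Let ratio_gt0 : (0 < ratio)%R. Proof. by have := ratio_ge4; lra. Qed.

Definition mean_truncation rho f l n : X -> R := fun y =>
  (n%:R^-1 * \sum_(j < n) truncation rho f l (ratio ^+ j.+1 * l) y)%R.

(** For each of the n levels one of two balls is good, and these two balls are
the same for all levels; so one of them is good for at least half of the
levels. *)
Lemma mean_truncation_average (rho : R) (f : X -> R) (l : R) n (x : X) :
  (0 < n)%N ->
  (0 < rho)%R -> (0 < l)%R -> (forall x, (0 <= f x)%R) ->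
  measurable_fun setT f -> superlevel rho f l x ->
  exists z k, ball z (rad (4 * rho) k) x /\
    (average_const / 2 * l * vol z (rad (4 * rho) k))%:E <=
      \int[mu]_(y in ball z (rad (4 * rho) k)) (mean_truncation rho f l n y)%:E.
Proof.
move=> n0 rho0 l0 f0 mf Ux.
have rho40 : (0 < 4 * rho)%R by rewrite mulr_gt0.
have [k hk] := truncation_average rho0 l0 f0 mf Ux.
pose L j : R := (ratio ^+ j.+1 * l)%R.
have L0 j : (0 <= L j)%R.
  by rewrite mulr_ge0 ?exprn_ge0// ltW//; have := ratio_ge4; lra.
have cL j : (c * l <= L j)%R.
  rewrite ler_pM2r// (@le_trans _ _ ratio)//.
    rewrite /ratio expr2; have := c_gt1; nra.
  by rewrite exprS ler_peMr ?exprn_ege1//; have := ratio_ge4; lra.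
have tc0 := average_const_gt0.
have avg i (P : pred 'I_n) : (n <= 2 * #|P|)%N ->
    (forall j, P j -> (average_const * l * vol x (rad (4 * rho) i))%:E <=
      \int[mu]_(y in ball x (rad (4 * rho) i)) (truncation rho f l (L j) y)%:E) ->
    (average_const / 2 * l * vol x (rad (4 * rho) i))%:E <=
      \int[mu]_(y in ball x (rad (4 * rho) i)) (mean_truncation rho f l n y)%:E.
  move=> nP hP; set B := ball x _ in hP *; set v := vol x _ in hP *.
  have v0 : (0 < v)%R by rewrite vol_gt0// rad_gt0.
  have mB : measurable B by exact: ball_is_measurable.
  have mt j : measurable_fun B (fun y => (truncation rho f l (L j) y)%:E).
    apply/measurable_funTS/measurable_EFinP; exact: truncation_measurable.
  have -> : \int[mu]_(y in B) (mean_truncation rho f l n y)%:E =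
      (n%:R^-1)%:E * \sum_(j < n) \int[mu]_(y in B) (truncation rho f l (L j) y)%:E.
    rewrite -ge0_integral_sum//; last first.
      by move=> j y _; rewrite lee_fin truncation_ge0.
    rewrite -ge0_integralZl_EFin//; last 2 first.
    - by move=> y _; apply: sume_ge0 => j _; rewrite lee_fin truncation_ge0.
    - exact: emeasurable_sum.
    by apply: eq_integral => y _; rewrite sumEFin -EFinM.
  have nR : (0 < n%:R :> R)%R by rewrite ltr0n.
  apply: (@le_trans _ _ ((n%:R^-1)%:E * \sum_(j < n | P j) (average_const * l * v)%:E)).
    rewrite sumEFin sumr_const -EFinM lee_fin.
    rewrite -[X in (_ <= _ * X)%R]mulr_natr ler_pdivlMl//.
    have : (n%:R <= 2 * #|P|%:R :> R)%R by rewrite -natrM ler_nat.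
    have : (0 <= average_const * l * v)%R by rewrite !mulr_ge0// ltW.
    set N : R := #|P|%:R; nra.
  rewrite lee_pmul2l//= ?lte_fin ?invr_gt0//.
  apply: (@le_trans _ _ (\sum_(j < n | P j) \int[mu]_(y in B) (truncation rho f l (L j) y)%:E)).
    by apply: lee_sum => j /hP.
  rewrite big_mkcond/=; apply: lee_sum => j _; case: ifP => // _.
  by apply: integral_ge0 => y _; rewrite lee_fin truncation_ge0.
pose P1 j := `[< (average_const * l * vol x (rad (4 * rho) k))%:E <=
  \int[mu]_(y in ball x (rad (4 * rho) k)) (truncation rho f l (L j) y)%:E >].
have [h|h] := leqP n (2 * #|[pred j : 'I_n | P1 j]|).
  exists x, k; split; first exact/ballxx/rad_gt0.
  by apply: (avg _ _ h) => j /asboolP.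
exists x, 0%N; split; first exact/ballxx/rad_gt0.
apply: (avg _ [pred j : 'I_n | ~~ P1 j]).
  have := cardC [pred j : 'I_n | P1 j]; rewrite card_ord.
  rewrite (_ : #|predC _| = #|[pred j : 'I_n | ~~ P1 j]|)//.
  by move: h; set A := #|_|; set B := #|_|; lia.
by move=> j /= /asboolP nP1; have [] := hk _ (cL j).
Qed.

Definition slab (f : X -> R) (l L : R) : X -> R := fun y =>
  (\1_([set x | (l / 2 < f x)%R] `&` [set x | (f x <= L)%R]) y * f y)%R.

Definition level_const (p A : R) : R :=
  (A * (c ^+ 2) `^ p * (2 / average_const) `^ p * 4 `^ p)%R.

(** If f contributes to the truncation at some level, then y lies outside the
smallest of the superlevel sets, and outside the exceptional set this bounds
f y. *)
Lemma mean_truncation_le (rho : R) (f : X -> R) (l : R) n y :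
  (0 < rho)%R -> (0 < l)%R -> (forall x, (0 <= f x)%R) -> (0 < n)%N ->
  ~ ([set x | (2 * c ^+ 2 * (ratio ^+ n * l) < f x)%R] `\`
      superlevel rho f (ratio ^+ n * l)%R) y ->
  (mean_truncation rho f l n y <=
    n%:R^-1 * (\sum_(j < n) (ratio ^+ j.+1 * l) *
      (y \in superlevel rho f (ratio ^+ j.+1 * l))%:R) +
    slab f l (ratio ^+ n.+1 * l) y)%R.
Proof.
move=> rho0 l0 f0 n0 nN.
have nR : (0 < n%:R :> R)%R by rewrite ltr0n.
have ratio0 : (0 < ratio)%R by have := ratio_ge4; lra.
have S0 : (0 <= slab f l (ratio ^+ n.+1 * l) y)%R by rewrite mulr_ge0.
rewrite /mean_truncation.
have -> : slab f l (ratio ^+ n.+1 * l) y =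
    (n%:R^-1 * \sum_(j < n) slab f l (ratio ^+ n.+1 * l) y)%R.
  by rewrite sumr_const card_ord -[X in _ = (_ * X)%R]mulr_natl mulKf ?gt_eqF.
rewrite -mulrDr ler_pM2l ?invr_gt0// -big_split/=; apply: ler_sum => j _.
rewrite /truncation lerD//.
rewrite {1}indicE; case: (boolP (y \in _)) => [|_]; last by rewrite mul0r.
move=> /set_mem[/= nU lf]; rewrite mul1r /slab indicE mem_set ?mul1r//.
split => //=; rewrite leNgt; apply/negP => fL; apply: nN; split => /=.
  apply: le_lt_trans fL; rewrite (exprS ratio n) -[leRHS]mulrA ler_wpM2r//.
    by rewrite mulr_ge0 ?exprn_ge0 ?(ltW l0) ?(ltW ratio0).
  by rewrite /ratio ler_wpM2r ?exprn_ge0 ?(ltW c_gt0)//; lra.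
move=> Un; apply: nU; apply: superlevel_le Un => //.
rewrite ler_wpM2r ?(ltW l0)//; apply: ler_weXn2l => //.
by have := ratio_ge4; lra.
Qed.

(** The weak type inequality for the mean of the truncations.  The factor n^-p,
against n terms in the sum, is the gain. *)
Lemma level_estimate (p A : R) (w : X -> R) (rho : R) (f : X -> R) (l : R) n :
  (1 < p)%R -> (0 <= A)%R -> (0 < rho)%R -> (0 < l)%R -> (0 < n)%N ->
  measurable_fun setT w -> (forall x, (0 < w x)%R) ->
  Muckenhoupt_bound mu p w A ->
  (forall x, (0 <= f x)%R) -> measurable_fun setT f ->
  (l `^ p)%:E * \int[mu]_(x in superlevel rho f l) (w x)%:E <=
  (level_const p A)%:E * (
    \sum_(j < n) ((n%:R^-1) `^ p * (ratio ^+ j.+1 * l) `^ p)%:E *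
      \int[mu]_(x in superlevel rho f (ratio ^+ j.+1 * l)) (w x)%:E +
    \int[mu]_x (slab f l (ratio ^+ n.+1 * l) x `^ p * w x)%:E).
Proof.
move=> p1 A0 rho0 l0 n0 mw w0 Aw f0 mf.
have p0 : (0 < p)%R by lra.
have ratio0 : (0 < ratio)%R by have := ratio_ge4; lra.
have rho40 : (0 < 4 * rho)%R by rewrite mulr_gt0.
have tc0 := average_const_gt0.
have t0 : (0 < average_const / 2 * l)%R by rewrite !mulr_gt0// invr_gt0.
have mU L : measurable (superlevel rho f L) by exact: superlevel_measurable.
set h := mean_truncation rho f l n.
have L0 j : (0 <= ratio ^+ j * l)%R by rewrite mulr_ge0 ?exprn_ge0 ?(ltW l0) ?(ltW ratio0).
have h0 y : (0 <= h y)%R.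
  by rewrite mulr_ge0// sumr_ge0// => j _; apply: truncation_ge0.
have mh : measurable_fun setT h.
  apply: measurable_funM => //; apply: measurable_sum => j.
  exact: truncation_measurable.
have := muckenhoupt_weak_type p1 rho40 t0 A0
  mw w0 Aw mh h0 (mU l).
move=> /(_ (fun x => mean_truncation_average
  n0 rho0 l0 f0 mf (x := x))).
set W := \int[mu]_(x in _) (w x)%:E => weak.
set F := slab f l (ratio ^+ n.+1 * l).
have F0 y : (0 <= F y)%R by rewrite mulr_ge0.
have mF : measurable_fun setT F.
  apply: measurable_funM => //; apply: measurable_indic; apply: measurableI.
    exact: measurable_gt_set.
  exact: measurable_le_set.
have mp (g : X -> R) : measurable_fun setT g ->
    measurable_fun setT (fun y => (g y `^ p * w y))%R.
  move=> mg; apply: measurable_funM => //.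
  exact: (measurableT_comp (measurable_powR _) mg).
pose U j := superlevel rho f (ratio ^+ j.+1 * l)%R.
pose K j : R := (n%:R^-1 `^ p * (ratio ^+ j.+1 * l) `^ p)%R.
have K0 j : (0 <= K j)%R by rewrite mulr_ge0// powR_ge0.
have hp : \int[mu]_x (h x `^ p * w x)%:E <= (4 `^ p)%:E *
    (\sum_(j < n) (K j)%:E * \int[mu]_(x in U j) (w x)%:E +
     \int[mu]_x (F x `^ p * w x)%:E).
  have -> : (4 `^ p)%:E *
    (\sum_(j < n) (K j)%:E * \int[mu]_(x in U j) (w x)%:E +
     \int[mu]_x (F x `^ p * w x)%:E) =
    \int[mu]_x ((4 `^ p)%:E * (\sum_(j < n) (K j)%:E * (\1_(U j) x * w x)%:E
     + (F x `^ p * w x)%:E)).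
    have mUw j : measurable_fun setT (fun x => (\1_(U j) x * w x)%:E).
      apply/measurable_EFinP; apply: measurable_funM => //.
      exact/measurable_indic/mU.
    have Uw0 j x : (0 <= (\1_(U j) x * w x)%:E)%E by rewrite lee_fin mulr_ge0 ?(ltW (w0 _)).
    have Fp0 x : (0 <= (F x `^ p * w x)%:E)%E.
      by rewrite lee_fin mulr_ge0 ?powR_ge0 ?(ltW (w0 _)).
    have mFp : measurable_fun setT (fun x => (F x `^ p * w x)%:E).
      by apply/measurable_EFinP; exact: mp.
    have ms : measurable_fun setT (fun x => \sum_(j < n) (K j)%:E * (\1_(U j) x * w x)%:E).
      by apply: emeasurable_sum => j; apply: measurable_funeM.
    have s0 x : 0 <= \sum_(j < n) (K j)%:E * (\1_(U j) x * w x)%:E.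
      by apply: sume_ge0 => j _; apply: mule_ge0; [rewrite lee_fin|exact: Uw0].
    rewrite ge0_integralZl_EFin ?powR_ge0//; last 2 first.
    - by move=> x _; rewrite adde_ge0.
    - exact: emeasurable_funD.
    congr (_ * _); rewrite ge0_integralD//; congr (_ + _).
    rewrite ge0_integral_sum//; last 2 first.
    - by move=> j; apply: measurable_funeM.
    - by move=> j x _; apply: mule_ge0; [rewrite lee_fin|exact: Uw0].
    apply: eq_bigr => j _; rewrite ge0_integralZl_EFin//; congr (_ * _).
    rewrite [LHS]integral_mkcond; apply: eq_integral => x _.
    by rewrite /patch indicE; case: (x \in U j); rewrite /= ?mul1r ?mul0r.
  apply: ae_ge0_le_integral => //.
  - by move=> x _; rewrite lee_fin mulr_ge0 ?powR_ge0 ?(ltW (w0 _)).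
  - by apply/measurable_EFinP; exact: mp.
  - move=> x _; rewrite mule_ge0 ?lee_fin ?powR_ge0// adde_ge0//.
      by apply: sume_ge0 => j _; apply: mule_ge0; rewrite lee_fin// mulr_ge0 ?(ltW (w0 _)).
    by rewrite lee_fin mulr_ge0 ?powR_ge0 ?(ltW (w0 _)).
  - apply: measurable_funeM; apply: emeasurable_funD.
      apply: emeasurable_sum => j; apply: measurable_funeM.
      apply/measurable_EFinP; apply: measurable_funM => //.
      exact/measurable_indic/mU.
    by apply/measurable_EFinP; exact: mp.
  have N0 := le_superlevel_ae rho0
    (mulr_gt0 (exprn_gt0 n ratio0) l0) f0 mf.
  exists ([set x | (2 * c ^+ 2 * (ratio ^+ n * l) < f x)%R] `\`
      superlevel rho f (ratio ^+ n * l)%R); split => //.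
    by apply: measurableD => //; exact: measurable_gt_set.
  move=> x /= nle; apply: contrapT => nN; apply: nle => _.
  under eq_bigr do rewrite -EFinM.
  rewrite sumEFin -EFinD -EFinM lee_fin.
  have wx := ltW (w0 x).
  under eq_bigr do rewrite mulrA.
  rewrite -mulr_suml -mulrDl mulrA ler_wpM2r//.
  apply: (@le_trans _ _ ((n%:R^-1 * (\sum_(j < n) (ratio ^+ j.+1 * l) *
      (x \in U j)%:R) + F x) `^ p)%R).
    apply: ge0_ler_powR; rewrite ?nnegrE ?(ltW p0)//.
      rewrite addr_ge0// mulr_ge0// sumr_ge0// => j _.
      by rewrite mulr_ge0.
    exact: mean_truncation_le.
  have s0 : (0 <= \sum_(j < n) ratio ^+ j.+1 * l * (x \in U j)%:R)%R.
    by rewrite sumr_ge0// => j _; rewrite mulr_ge0.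
  apply: (le_trans (powRD_le _ _ _)) => //; first exact: ltW.
    by rewrite mulr_ge0.
  rewrite (_ : 4 = 2 * 2)%R; last by ring.
  rewrite (@powRM _ 2 2)// -mulrA ler_wpM2l ?powR_ge0// mulrDr lerD//; last first.
    by rewrite ler_peMl ?powR_ge0// -[leLHS](powRr0 2) ler_powR ?(ltW p0)// ler1n.
  rewrite powRM//.
  have := powR_geometric_sum (fun j => x \in U j) n _ (ltW l0) p0.
  move=> /(_ ratio); have -> : (2 <= ratio)%R by have := ratio_ge4; lra.
  move=> /(_ isT) => G.
  apply: (le_trans (ler_wpM2l (powR_ge0 _ _) G)).
  rewrite mulrCA ler_wpM2l ?powR_ge0// mulr_sumr; apply: ler_sum => j _.
  by rewrite /K indicE mulrA.
have tp : (0 < (average_const / 2) `^ p)%R by rewrite powR_gt0// divr_gt0.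
rewrite -(@lee_pmul2l _ ((average_const / 2) `^ p)%:E)// muleA -EFinM.
rewrite -powRM ?(ltW l0) ?divr_ge0 ?(ltW tc0)//.
apply: (le_trans weak).
rewrite muleA -EFinM.
have -> : ((average_const / 2) `^ p * level_const p A =
    A * (c ^+ 2) `^ p * 4 `^ p)%R.
  rewrite /level_const.
  transitivity (A * (c ^+ 2) `^ p * 4 `^ p *
    ((average_const / 2) `^ p * (2 / average_const) `^ p))%R; first by ring.
  rewrite -powRM ?divr_ge0 ?(ltW tc0)//.
  rewrite (_ : average_const / 2 * (2 / average_const) = 1)%R ?powR1 ?mulr1//.
  by field; rewrite gt_eqF.
rewrite [in leRHS]EFinM -muleA; apply: lee_wpmul2l => //.
by rewrite lee_fin mulr_ge0// powR_ge0.
Qed.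

(** * Summation over the levels *)
Lemma superlevel_eq0 (rho : R) (f : X -> R) (l : R) :
  (0 < rho)%R -> (0 < l)%R -> (forall x, (0 <= f x)%R) ->
  measurable_fun setT f -> (forall x, (f x <= l)%R) ->
  superlevel rho f l = set0.
Proof.
move=> rho0 l0 f0 mf fl; apply/seteqP; split => // x [z [k [_]]].
have r0 := rad_gt0 k rho0.
apply/negP; rewrite -leNgt EFinM -volE// -(integral_cst mu (ball_is_measurable z _) l%:E).
exact: (@le_integral_EFin _ _ _ mu f (cst l)) (ball_is_measurable z _) _ _ _ _.
Qed.

Definition sum_const (p A : R) (e : R) n : R :=
  (2 * level_const p A * ((ratio ^+ n.+1) `^ e * n.+2%:R))%R.

(** A given value of f lies in at most n + 2 of the slabs, as
2 ratio^(n+1) <= ratio^(n+2). *)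
Lemma sum_slab_le (f : X -> R) (l q : R) n M y : (0 < l)%R ->
  (forall x, (0 <= f x)%R) -> (0 < q)%R ->
  (\sum_(m < M) slab f (ratio ^+ m * l) (ratio ^+ n.+1 * (ratio ^+ m * l)) y `^ q
   <= n.+2%:R * f y `^ q)%R.
Proof.
move=> l0 f0 q0.
pose P m := (ratio ^+ m * l / 2 < f y)%R && (f y <= ratio ^+ n.+1 * (ratio ^+ m * l))%R.
have E m : (slab f (ratio ^+ m * l) (ratio ^+ n.+1 * (ratio ^+ m * l)) y `^ q =
    (P m)%:R * f y `^ q)%R.
  rewrite /slab indicE (_ : _ \in _ = P m).
    by case: (P m); rewrite /= ?mul1r// !mul0r powR0// gt_eqF.
  by apply/idP/idP => [/set_mem[/= h1 h2]|/andP[h1 h2]]; [exact/andP|exact/mem_set].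
under eq_bigr do rewrite E.
rewrite -mulr_suml ler_wpM2r ?powR_ge0// -natr_sum ler_nat.
apply: sum_window_le => // i j /andP[_ fi] /andP[jf _] ij.
have {jf} := lt_le_trans jf fi; rewrite ltr_pdivrMr// mulrA -!mulrA.
rewrite ltnNge; apply: contraPN => nij; apply/negP; rewrite -leNgt.
have -> : j = (n.+2 + (j - n.+2 - i) + i)%N by lia.
rewrite !exprD.
have h : (1 <= ratio ^+ (j - n.+2 - i))%R.
  by apply: exprn_ege1; have := ratio_ge4; lra.
rewrite (exprS ratio n.+1).
have a0 : (0 < ratio ^+ n.+1)%R by rewrite exprn_gt0.
have b0 : (0 < ratio ^+ i)%R by rewrite exprn_gt0.
set u := (ratio ^+ n.+1)%R in a0 *; set v := (ratio ^+ (j - n.+2 - i))%R in h *.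
set t := (ratio ^+ i)%R in b0 *.
rewrite [leLHS](_ : _ = u * (t * l) * 2)%R; last by ring.
rewrite [leRHS](_ : _ = u * (t * l) * (ratio * v))%R; last by ring.
rewrite ler_wpM2l ?mulr_ge0 ?(ltW l0) ?(ltW a0) ?(ltW b0)//.
have := ratio_ge4; nra.
Qed.

(** The level inequality is multiplied by the power -e of the level and summed.
As f is bounded, the sum is finite from above, and it is cut off from below at
an arbitrary l; since the levels on the right-hand side are larger than the one
on the left, the cut-off does no harm. *)
Lemma level_sum (p A e : R) (w : X -> R) (rho : R) (f : X -> R) (l : R) n M :
  (1 < p)%R -> (0 < A)%R -> (0 < e < p)%R ->
  (0 < rho)%R -> (0 < l)%R -> (0 < n)%N ->
  measurable_fun setT w -> (forall x, (0 < w x)%R) ->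
  Muckenhoupt_bound mu p w A ->
  (forall x, (0 <= f x)%R) -> measurable_fun setT f ->
  (forall x, (f x <= ratio ^+ M * l)%R) ->
  (forall m, \int[mu]_(x in superlevel rho f (ratio ^+ m * l)) (w x)%:E < +oo) ->
  (level_const p A * ((n%:R^-1) `^ p * 2 * n%:R) <= 2^-1)%R ->
  ((ratio ^+ n) `^ e <= 2)%R ->
  \sum_(m < M) ((ratio ^+ m * l) `^ (p - e))%:E *
    \int[mu]_(x in superlevel rho f (ratio ^+ m * l)) (w x)%:E <=
  (sum_const p A e n)%:E * \int[mu]_x (f x `^ (p - e) * w x)%:E.
Proof.
move=> p1 Apos /andP[e0 ep] rho0 l0 n0 mw w0 Aw f0 mf fM Woo Dn an.
have A0 := ltW Apos; set q := (p - e)%R; set Q := \int[mu]_x (f x `^ q * w x)%:E.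
have q0 : (0 < q)%R by rewrite subr_gt0.
have tc0 := average_const_gt0.
set D := level_const p A in Dn *.
have Dpos : (0 < D)%R.
  by rewrite /D /level_const !mulr_gt0 ?powR_gt0 ?divr_gt0 ?exprn_gt0.
have D0 := ltW Dpos.
have Q0 : 0 <= Q by apply: integral_ge0 => x _; rewrite lee_fin mulr_ge0 ?powR_ge0 ?(ltW (w0 _)).
pose L m : R := (ratio ^+ m * l)%R.
have L0 m : (0 < L m)%R by rewrite mulr_gt0// exprn_gt0.
pose W m := \int[mu]_(x in superlevel rho f (L m)) (w x)%:E.
have W0 m : 0 <= W m by apply: integral_ge0 => x _; rewrite lee_fin ltW.
have Wfin m : W m \is a fin_num by rewrite ge0_fin_numE//; exact: Woo.
pose F m := slab f (L m) (ratio ^+ n.+1 * L m).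
have F0 m x : (0 <= F m x)%R by rewrite mulr_ge0.
have mF m : measurable_fun setT (F m).
  apply: measurable_funM => //; apply: measurable_indic; apply: measurableI.
    exact: measurable_gt_set.
  exact: measurable_le_set.
have mp (g : X -> R) s : measurable_fun setT g ->
    measurable_fun setT (fun y => (g y `^ s * w y))%R.
  move=> mg; apply: measurable_funM => //.
  exact: (measurableT_comp (measurable_powR _) mg).
pose J m := \int[mu]_x (F m x `^ q * w x)%:E.
have J0 m : 0 <= J m by apply: integral_ge0 => x _; rewrite lee_fin mulr_ge0 ?powR_ge0 ?(ltW (w0 _)).
have JQ : \sum_(m < M) J m <= n.+2%:R%:E * Q.
  rewrite -ge0_integral_sum//; last 2 first.
  - by move=> m; apply/measurable_EFinP; exact: mp.
  - by move=> m x _; rewrite lee_fin mulr_ge0 ?powR_ge0 ?(ltW (w0 _)).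
  rewrite -ge0_integralZl_EFin//; last 2 first.
  - by move=> x _; rewrite lee_fin mulr_ge0 ?powR_ge0 ?(ltW (w0 _)).
  - by apply/measurable_EFinP; exact: mp.
  apply: ge0_le_integral => //.
  - by move=> x _; apply: sume_ge0 => m _; rewrite lee_fin mulr_ge0 ?powR_ge0 ?(ltW (w0 _)).
  - by apply: emeasurable_sum => m; apply/measurable_EFinP; exact: mp.
  - by apply: measurable_funeM; apply/measurable_EFinP; exact: mp.
  - move=> x _; rewrite sumEFin -EFinM lee_fin -mulr_suml mulrA.
    by rewrite ler_wpM2r ?(ltW (w0 _))//; exact: sum_slab_le.
have [Qoo|Qfin] := eqVneq Q +oo.
  rewrite Qoo gt0_muley ?leey// lte_fin /sum_const -/D.
  have rn : (0 < ratio ^+ n.+1)%R by rewrite exprn_gt0.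
  by apply: mulr_gt0; apply: mulr_gt0; rewrite ?Dpos ?powR_gt0 ?ltr0n.
have {}Qfin : Q \is a fin_num by rewrite ge0_fin_numE// ltey.
have Jfin m : (m < M)%N -> J m \is a fin_num.
  move=> mM; rewrite (ge0_fin_numE (J0 m)).
  apply: (@le_lt_trans _ _ (n.+2%:R%:E * Q)); last first.
    by rewrite -(fineK Qfin) -EFinM ltry.
  apply: le_trans JQ; rewrite (bigD1 (Ordinal mM))//= leeDl//.
  by apply: sume_ge0 => j _; exact: J0.
pose v m : R := (L m `^ q * fine (W m))%R.
pose b m : R := if (m < M)%N then ((ratio ^+ n.+1) `^ e * fine (J m))%R else 0%R.
pose kappa j : R := ((n%:R^-1) `^ p * (ratio ^+ j.+1) `^ e)%R.
have v0 m : (0 <= v m)%R by rewrite mulr_ge0 ?powR_ge0// fine_ge0.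
have vM m : (M <= m)%N -> v m = 0%R.
  move=> Mm; rewrite /v /W superlevel_eq0 ?integral_set0 ?mulr0// => x.
  apply: le_trans (fM x) _; rewrite ler_wpM2r ?(ltW l0)// ler_weXn2l//.
  by have := ratio_ge4; lra.
have step m : (v m <= D * (\sum_(j < n) kappa j * v (m + j.+1)%N + b m))%R.
  have [mM|Mm] := ltnP m M; last first.
    rewrite vM//; apply: mulr_ge0 => //; apply: addr_ge0.
      by apply: sumr_ge0 => j _; rewrite !mulr_ge0 ?powR_ge0 ?fine_ge0.
    by rewrite /b ltnNge Mm.
  have := level_estimate p1 A0 rho0 (L0 m) n0 mw
    w0 Aw f0 mf.
  rewrite -/(W m) -/(F m) -/D.
  have LE j : (ratio ^+ j.+1 * L m = L (m + j.+1)%N)%R.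
    by rewrite /L mulrA -exprD addnC.
  under eq_bigr do rewrite LE -/(W _).
  set I := \int[mu]_x (F m x `^ p * w x)%:E.
  have IJ : I <= ((ratio ^+ n.+1 * L m) `^ e)%:E * J m.
    rewrite -ge0_integralZl_EFin ?powR_ge0//; last 2 first.
    - by move=> x _; rewrite lee_fin mulr_ge0 ?powR_ge0 ?(ltW (w0 _)).
    - by apply/measurable_EFinP; exact: mp.
    under [leRHS]eq_integral do rewrite -EFinM.
    apply: le_integral_EFin => //.
    - exact: mp.
    - by apply: measurable_funM => //; exact: mp.
    - by move=> x; rewrite mulr_ge0 ?powR_ge0 ?(ltW (w0 _)).
    - move=> x _; rewrite mulrA ler_wpM2r ?(ltW (w0 _))//.
      rewrite [X in (_ `^ X <= _)%R](_ : p = e + q)%R; last by rewrite /q; ring.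
      rewrite powRD; last by rewrite gt_eqF// addr_gt0.
      rewrite ler_wpM2r ?powR_ge0//; apply: ge0_ler_powR; rewrite ?nnegrE ?(ltW e0)//.
        by rewrite mulr_ge0 ?exprn_ge0 ?(ltW (L0 _)) ?(ltW ratio_gt0).
      rewrite /F /slab indicE; case: (boolP (_ \in _)) => [|_].
        by move=> /set_mem[_ /=]; rewrite mul1r.
      by rewrite mul0r mulr_ge0 ?exprn_ge0 ?(ltW (L0 _)) ?(ltW ratio_gt0).
  have Ifin : I \is a fin_num.
    rewrite ge0_fin_numE; last first.
      by apply: integral_ge0 => x _; rewrite lee_fin mulr_ge0 ?powR_ge0 ?(ltW (w0 _)).
    by apply: le_lt_trans IJ _; rewrite -(fineK (Jfin _ mM)) -EFinM ltry.
  move: IJ; rewrite -(fineK Ifin) -(fineK (Jfin _ mM)) -EFinM lee_fin => IJ.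
  rewrite -(fineK (Wfin m)) -EFinM.
  under eq_bigr do rewrite -(fineK (Wfin _)) -EFinM.
  rewrite sumEFin -EFinD -EFinM lee_fin => h.
  have Le0 : (0 < L m `^ (- e))%R by rewrite powR_gt0.
  have {h} := ler_wpM2l (ltW Le0) h.
  have LL : (L m `^ (- e) * L m `^ p = L m `^ q)%R.
    by rewrite -powRD ?(gt_eqF (L0 m)) ?implybT// addrC.
  rewrite mulrA LL => /le_trans; apply.
  rewrite mulrCA ler_wpM2l// mulrDr lerD//.
    rewrite mulr_sumr; apply: ler_sum => j _.
    rewrite -LE /v /kappa -LE.
    rewrite [leLHS](_ : _ = n%:R^-1 `^ p * fine (W (m + j.+1)%N) *
      (L m `^ (- e) * (ratio ^+ j.+1 * L m) `^ p))%R; last by ring.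
    rewrite [leRHS](_ : _ = n%:R^-1 `^ p * fine (W (m + j.+1)%N) *
      ((ratio ^+ j.+1) `^ e * (ratio ^+ j.+1 * L m) `^ q))%R; last by ring.
    rewrite ler_wpM2l ?mulr_ge0 ?powR_ge0 ?fine_ge0//.
    have rj : (0 < ratio ^+ j.+1)%R by rewrite exprn_gt0.
    rewrite (@powRM _ _ _ p (ltW rj) (ltW (L0 m))) (@powRM _ _ _ q (ltW rj) (ltW (L0 m))).
    rewrite mulrCA LL mulrA -powRD ?(gt_eqF rj) ?implybT//.
    by rewrite (_ : e + q = p)%R// /q; ring.
  rewrite /b mM; apply: (le_trans (ler_wpM2l (ltW Le0) IJ)).
  rewrite mulrA (ler_wpM2r (fine_ge0 (J0 m)))//.
  have rn : (0 < ratio ^+ n.+1)%R by rewrite exprn_gt0.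
  rewrite (@powRM _ _ _ e (ltW rn) (ltW (L0 m))).
  rewrite mulrCA -powRD ?(gt_eqF (L0 m)) ?implybT// addNr powRr0 mulr1//.
have := @absorb_shifted_sums _ v b kappa D (n%:R^-1 `^ p * 2)%R
  ((ratio ^+ n.+1) `^ e * (n.+2%:R * fine Q))%R n M D0 v0 vM _ Dn step _.
have -> : \sum_(m < M) (L m `^ q)%:E * W m = (\sum_(m < M) v m)%:E.
  by rewrite -sumEFin; apply: eq_bigr => m _; rewrite /v EFinM fineK.
move=> h; rewrite -(fineK Qfin) -EFinM lee_fin.
apply: le_trans (h _ _) _.
- move=> j jn; rewrite /kappa mulr_ge0 ?powR_ge0//= ler_wpM2l ?powR_ge0//.
  apply: le_trans an; apply: ge0_ler_powR; rewrite ?nnegrE ?exprn_ge0 ?(ltW e0) ?(ltW ratio_gt0)//.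
  by apply: ler_weXn2l => //; have := ratio_ge4; lra.
- rewrite (eq_bigr (fun m : 'I_M => (ratio ^+ n.+1) `^ e * fine (J m)))%R; last first.
    by move=> m _; rewrite /b ltn_ord.
  rewrite -mulr_sumr; apply: (ler_wpM2l (powR_ge0 _ _)).
  rewrite -lee_fin EFinM (fineK Qfin); apply: le_trans JQ.
  by rewrite -sumEFin; apply: lee_sum => m _; rewrite (fineK (Jfin _ (ltn_ord m))).
- rewrite /sum_const -/D le_eqVlt; apply/orP; left; apply/eqP; ring.
Qed.

(** * The strong type inequality *)
Lemma lt_average (t : R) z r (g : X -> \bar R) : (0 < r)%R ->
  (forall x, 0 <= g x) ->
  (t%:E < average mu (ball z r) g) = ((t * vol z r)%:E < \int[mu]_(y in ball z r) g y).
Proof.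
move=> r0 g0; have v0 := vol_gt0 z r0.
rewrite /average volE// inver gt_eqF// muleC lte_pdivlMr// EFinM muleC.
Qed.

Lemma maximal_gt (f : X -> \bar R) (t : R) x : t%:E < maximal mu f x ->
  exists z r, [/\ (0 < r)%R, ball z r x &
    (t * vol z r)%:E < \int[mu]_(y in ball z r) `|f y|].
Proof.
move=> /ereal_sup_gt[_ [[z r] /= [r0 zx] <-]]; rewrite lt_average// => h.
by exists z, r.
Qed.

Lemma maximal_measurable (f : X -> \bar R) : measurable_fun setT (maximal mu f).
Proof.
apply: (measurability _ (ErealGenOInfty.measurableE R)) => // _ [_ [t ->] <-].
rewrite setTI; apply: open_set_measurable.
rewrite (_ : _ @^-1` _ = \bigcup_(p in [set p : X * R | (0 < p.2)%R /\
    t%:E < average mu (ball p.1 p.2) (fun y => `|f y|)]) ball p.1 p.2).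
  by apply: bigcup_open => p _; exact: ball_is_open.
apply/seteqP; split => [x /=|x [[z r]/= [r0 h] zx]]; rewrite in_itv/= andbT.
  move=> /ereal_sup_gt[_ [[z r] /= [r0 zx] <-]] h.
  by exists (z, r).
by apply: (lt_le_trans h); apply: ereal_sup_ubound; exists (z, r).
Qed.

Lemma maximal_ge0 (f : X -> \bar R) x : 0 <= maximal mu f x.
Proof.
apply: (@le_trans _ _ (average mu (ball x 1) (fun y => `|f y|))).
  rewrite /average mule_ge0 ?inve_ge0//; exact: integral_ge0.
by apply: ereal_sup_ubound; exists (x, 1%R) => //=; split => //; exact: ballxx.
Qed.

(** Any ball can be enlarged, by a factor less than 2, to one of the discrete
radii. *)
Lemma rad_between (rho r : R) : (0 < r)%R -> (r <= rho)%R ->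
  exists j, (r <= rad rho j < 2 * r)%R.
Proof.
move=> r0 rrho; have ex := rad_small rho r0.
case: (ex_minnP ex) => -[|j] jr minj.
  by move: jr; rewrite rad0 ltNge rrho.
exists j; rewrite leNgt; apply/andP; split.
  by apply/negP => /minj; rewrite ltnn.
by rewrite radS ltr_pM2l.
Qed.

Definition cutoff (f : X -> \bar R) (x0 : X) (k : nat) : X -> R := fun x =>
  (\1_(ball x0 (k%:R : R)) x * fine (mine `|f x| k%:R%:E)%E)%R.

Let mine_ge0 (y : \bar R) (k : nat) : 0 <= mine `|y| k%:R%:E.
Proof. by rewrite le_min abse_ge0 lee_fin ler0n. Qed.

Let mine_fin_num (y : \bar R) (k : nat) : mine `|y| k%:R%:E \is a fin_num.
Proof. by rewrite ge0_fin_numE ?mine_ge0// gt_min ltry orbT. Qed.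

Lemma cutoff_ge0 f x0 k x : (0 <= cutoff f x0 k x)%R.
Proof. by rewrite mulr_ge0// fine_ge0. Qed.

Lemma cutoff_measurable f x0 k : measurable_fun setT f ->
  measurable_fun setT (cutoff f x0 k).
Proof.
move=> mf; apply: measurable_funM.
  by apply: measurable_indic; exact: ball_is_measurable.
apply: measurableT_comp => //; apply: measurable_mine => //.
exact: measurableT_comp.
Qed.

Lemma cutoff_le f x0 k x : (cutoff f x0 k x <= k%:R)%R.
Proof.
rewrite /cutoff indicE; case: (x \in _); last by rewrite mul0r.
by rewrite mul1r -lee_fin fineK// ge_min lexx orbT.
Qed.

Lemma cutoff_abs_le f x0 k x : (cutoff f x0 k x)%:E <= `|f x|.
Proof.
rewrite /cutoff indicE; case: (x \in _); last by rewrite mul0r abse_ge0.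
by rewrite mul1r fineK// ge_min lexx.
Qed.

Lemma cutoff_nondecreasing f x0 x :
  {homo (fun k => cutoff f x0 k x) : k l / (k <= l)%N >-> (k <= l)%R}.
Proof.
move=> k l kl; have klR : (k%:R <= l%:R :> R)%R by rewrite ler_nat.
rewrite /cutoff; apply: ler_pM; [by []|exact: fine_ge0 (mine_ge0 _ _)| |].
  rewrite !indicE; have [xk|nxk] := pselect (ball x0 (k%:R : R) x).
    by rewrite !mem_set//; exact: le_ball xk.
  by rewrite memNset.
by rewrite fine_le// le_min ge_min lexx/= ge_min lee_fin klR orbT.
Qed.

Lemma cutoff_cvg f x0 x : (cutoff f x0 k x)%:E @[k --> \oo] --> `|f x|.
Proof.
have [m xm] : exists m, forall k, (m <= k)%N -> ball x0 (k%:R : R) x.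
  exists (Num.truncn (mdist x0 x)).+1 => k mk; rewrite ballEmdist/=.
  by apply: (lt_le_trans (truncnS_gt _)); rewrite ler_nat.
have cE k : (m <= k)%N -> (cutoff f x0 k x)%:E = mine `|f x| k%:R%:E.
  by move=> mk; rewrite /cutoff indicE mem_set ?mul1r ?fineK//; exact: xm.
have [foo|] := eqVneq `|f x| +oo.
  rewrite foo; apply/cvgeyPge => A; exists (maxn m (Num.truncn A).+1) => // k /=.
  rewrite geq_max => /andP[mk Ak]; rewrite cE// foo min_r ?leey// lee_fin.
  by rewrite ltW// (lt_le_trans (truncnS_gt _))// ler_nat.
rewrite -ltey -ge0_fin_numE// => ffin.
apply: cvg_near_cst; exists (maxn m (Num.truncn (fine `|f x|)).+1) => // k /=.
rewrite geq_max => /andP[mk Ak]; rewrite cE// min_l//.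
rewrite -(fineK ffin) lee_fin.
by rewrite ltW// (lt_le_trans (truncnS_gt _))// ler_nat.
Qed.

(** The factor c is the price of passing to the discrete radii. *)
Lemma maximal_superlevel (f : X -> \bar R) x0 (t : R) x : measurable_fun setT f ->
  (0 < t)%R -> t%:E < maximal mu f x ->
  exists N, forall k, (N <= k)%N ->
    superlevel (2 ^+ k)%R (cutoff f x0 k) (t / c)%R x.
Proof.
move=> mf t0 /maximal_gt[z [r [r0 zx h]]].
have mB : measurable (ball z r) by exact: ball_is_measurable.
pose I k := \int[mu]_(y in ball z r) (cutoff f x0 k y)%:E.
have Ind : nondecreasing_seq I.
  move=> k l kl; apply: le_integral_EFin => //; first exact: cutoff_measurable.
  - exact: cutoff_measurable.
  - exact: cutoff_ge0.
  - by move=> y _; exact: cutoff_nondecreasing.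
have [k0 k0h] : exists k0, (t * vol z r)%:E < I k0.
  have E : \int[mu]_(y in ball z r) `|f y| =
      \int[mu]_(y in ball z r) limn (fun k => (cutoff f x0 k y)%:E).
    apply: eq_integral => y _; apply/esym/cvg_lim => //; exact: cutoff_cvg.
  move: h; rewrite E monotone_convergence//; last 3 first.
  - by move=> k; apply/measurable_funTS/measurable_EFinP; exact: cutoff_measurable.
  - by move=> k y _; rewrite lee_fin cutoff_ge0.
  - by move=> y _ k l kl; rewrite lee_fin cutoff_nondecreasing.
  rewrite (cvg_lim _ (ereal_nondecreasing_cvgn Ind))//.
  by move=> /ereal_sup_gt[_ [k _ <-] hk]; exists k.
pose j0 := (Num.truncn r).+1.
exists (maxn k0 j0) => k; rewrite geq_max => /andP[k0k jk].
have rk : (r <= 2 ^+ k)%R.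
  rewrite ltW// (lt_le_trans (truncnS_gt _))// -natrX ler_nat (leq_trans jk)//.
  exact/ltnW/ltn_expl.
have [j /andP[rj jr]] := rad_between r0 rk.
have rad_pos : (0 < rad (2 ^+ k : R) j)%R by apply: (lt_le_trans r0).
exists z, j; split; first exact: le_ball zx.
apply: (@le_lt_trans _ _ (t * vol z r)%:E).
  rewrite lee_fin -mulrA ler_pM2l// ler_pdivrMl//.
  apply: le_trans (vol_double z r0); apply: vol_le => //.
    by rewrite mulr_gt0.
  by apply: le_ball; exact: ltW.
apply: (lt_le_trans k0h); apply: (le_trans (Ind _ _ k0k)).
apply: subset_integral_EFin => //; [exact: ball_is_measurable|exact: cutoff_measurable| |exact: le_ball].
exact: cutoff_ge0.
Qed.

Lemma lt_pow_ratio (y : R) : exists N, forall k, (N <= k)%N -> (y < ratio ^+ k)%R.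
Proof.
exists (Num.truncn y).+1 => k Nk; apply: (lt_le_trans (truncnS_gt _)).
apply: (@le_trans _ _ (2 ^+ k)%R).
  by rewrite -natrX ler_nat (leq_trans Nk)// ltnW// ltn_expl.
by apply: lerXn2r; rewrite ?nnegrE ?(ltW ratio_gt0)//; have := ratio_ge4; lra.
Qed.

Lemma superlevel_sub_ball (rho : R) (f : X -> R) (l r : R) x0 :
  (0 < rho)%R -> (0 < l)%R -> (forall x, ~ ball x0 r x -> f x = 0%R) ->
  superlevel rho f l `<=` ball x0 (r + 2 * rho)%R.
Proof.
move=> rho0 l0 fr x [z [k [zx h]]].
have rk0 := rad_gt0 k rho0.
have rk : (rad rho k <= rho)%R by have := rad_le rho0 (leq0n k); rewrite rad0.
have [y [zy xy]] : exists y, ball z (rad rho k) y /\ ball x0 r y.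
  apply: contrapT => no; move: h; apply/negP; rewrite -leNgt.
  rewrite integral0_eq ?lee_fin ?mulr_ge0 ?(ltW l0) ?(ltW (vol_gt0 _ _))//.
  by move=> y zy; rewrite fr// => xy; apply: no; exists y.
move: zx zy xy; rewrite !ballEmdist/= => zx zy xy.
have := mdist_tri x0 y x; have := mdist_tri y z x.
rewrite (mdistC y z); lra.
Qed.

(** For the k-th cutoff of f, with radii at most 2^k and the levels from
ratio^-k to ratio^k, the function G k is a discrete version of the power q of
the maximal function times w.  Its integral is bounded by [level_sum], and its
lower limit dominates the function of interest. *)
Lemma strong_type (p A e : R) (w : X -> R) n (x0 : X) (f : X -> \bar R) :
  (1 < p)%R -> (0 < A)%R -> (0 < e < p)%R -> (0 < n)%N ->
  measurable_fun setT w -> (forall x, (0 < w x)%R) ->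
  (forall x r, (0 < r)%R -> \int[mu]_(y in ball x r) (w y)%:E < +oo) ->
  Muckenhoupt_bound mu p w A ->
  (level_const p A * ((n%:R^-1) `^ p * 2 * n%:R) <= 2^-1)%R ->
  ((ratio ^+ n) `^ e <= 2)%R ->
  measurable_fun setT f ->
  \int[mu]_x (maximal mu f x `^ (p - e) * (w x)%:E) <=
  (c `^ (p - e) * (ratio `^ (p - e) * sum_const p A e n))%:E *
  \int[mu]_x (`|f x| `^ (p - e) * (w x)%:E).
Proof.
move=> p1 A0 ep n0 mw w0 woo Aw Dn an mf.
set q := (p - e)%R; have q0 : (0 < q)%R by rewrite subr_gt0; have /andP[] := ep.
pose F k := cutoff f x0 k.
pose L k m : R := (ratio ^+ m * ratio ^- k)%R.
have L0 k m : (0 < L k m)%R by rewrite divr_gt0// exprn_gt0.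
pose U k m := superlevel (2 ^+ k)%R (F k) (L k m).
have mU k m : measurable (U k m) by exact: superlevel_measurable.
pose G k x := \sum_(m < 2 * k) ((ratio * L k m) `^ q)%:E * (\1_(U k m) x * w x)%:E.
have Uw0 k m x : 0 <= (\1_(U k m) x * w x)%:E.
  by rewrite lee_fin mulr_ge0// ltW.
have G0 k x : 0 <= G k x.
  by apply: sume_ge0 => m _; apply: mule_ge0; [rewrite lee_fin powR_ge0|exact: Uw0].
have mUw k m : measurable_fun setT (fun x => (\1_(U k m) x * w x)%:E).
  apply/measurable_EFinP; apply: measurable_funM => //.
have mG k : measurable_fun setT (G k).
  by apply: emeasurable_sum => m; apply: measurable_funeM.
set Q := \int[mu]_x (`|f x| `^ q * (w x)%:E).
have mfq : measurable_fun setT (fun x => `|f x| `^ q * (w x)%:E).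
  apply: emeasurable_funM; last exact/measurable_EFinP.
  apply: (measurableT_comp (measurable_poweR q)).
  exact: measurableT_comp.
have tc0 := average_const_gt0.
have D0 : (0 <= level_const p A)%R.
  by rewrite /level_const !mulr_ge0 ?powR_ge0 ?(ltW A0).
have S0 : (0 <= sum_const p A e n)%R.
  by apply: mulr_ge0; [exact: mulr_ge0|rewrite mulr_ge0 ?powR_ge0].
have FQ k : \int[mu]_x (F k x `^ q * w x)%:E <= Q.
  apply: ge0_le_integral => //.
  - by move=> x _; rewrite lee_fin mulr_ge0 ?powR_ge0 ?(ltW (w0 _)).
  - apply/measurable_EFinP; apply: measurable_funM => //.
    apply: (measurableT_comp (measurable_powR _)); exact: cutoff_measurable.
  - move=> x _; rewrite EFinM lee_wpmul2r ?lee_fin ?(ltW (w0 _))//.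
    rewrite -poweR_EFin; apply: gt0_ler_poweR; rewrite ?(ltW q0)//.
    + by rewrite in_itv/= leey lee_fin cutoff_ge0.
    + by rewrite in_itv/= leey abse_ge0.
    + exact: cutoff_abs_le.
have GQ k : \int[mu]_x G k x <= (ratio `^ q * sum_const p A e n)%:E * Q.
  rewrite ge0_integral_sum//; last 2 first.
  - by move=> m; apply: measurable_funeM.
  - by move=> m x _; apply: mule_ge0; [rewrite lee_fin powR_ge0|exact: Uw0].
  have -> : \sum_(m < 2 * k) \int[mu]_x (((ratio * L k m) `^ q)%:E * (\1_(U k m) x * w x)%:E)
      = (ratio `^ q)%:E * \sum_(m < 2 * k) (L k m `^ q)%:E *
        \int[mu]_(x in U k m) (w x)%:E.
    rewrite ge0_sume_distrr; last first.
      move=> m _; apply: mule_ge0; first by rewrite lee_fin powR_ge0.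
      by apply: integral_ge0 => x _; rewrite lee_fin ltW.
    apply: eq_bigr => m _; rewrite ge0_integralZl_EFin ?powR_ge0//.
    rewrite (@powRM _ _ _ q (ltW ratio_gt0) (ltW (L0 k m))) EFinM muleA.
    congr (_ * _); rewrite [RHS]integral_mkcond; apply: eq_integral => x _.
    by rewrite /patch indicE; case: (x \in U k m); rewrite /= ?mul1r ?mul0r.
  rewrite EFinM -muleA lee_wpmul2l ?lee_fin ?powR_ge0//.
  apply: (@le_trans _ _ ((sum_const p A e n)%:E * \int[mu]_x (F k x `^ q * w x)%:E)).
    apply: (level_sum (M := 2 * k)) => //.
    - by rewrite invr_gt0 exprn_gt0.
    - exact: cutoff_ge0.
    - exact: cutoff_measurable.
    - move=> x; apply: (le_trans (cutoff_le _ _ _ _)).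
      rewrite mul2n -addnn exprD mulfK ?expf_neq0 ?gt_eqF//.
      apply: (@le_trans _ _ (2 ^+ k)%R).
        by rewrite -natrX ler_nat ltnW// ltn_expl.
      by apply: lerXn2r; rewrite ?nnegrE ?(ltW ratio_gt0)//; have := ratio_ge4; lra.
    - move=> m; have k2 : (0 < 2 ^+ k :> R)%R by rewrite exprn_gt0.
      apply: (@le_lt_trans _ _ (\int[mu]_(y in ball x0 (k%:R + 2 * 2 ^+ k)%R) (w y)%:E)).
        apply: subset_integral_EFin => //.
        + exact: superlevel_measurable.
        + exact: ball_is_measurable.
        + by move=> x; exact: ltW.
        + apply: superlevel_sub_ball => //; first exact: L0.
          by move=> x nx; rewrite /F /cutoff indicE memNset ?mul0r.
      by apply: woo; rewrite ltr_wpDl// mulr_gt0.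
  by apply: lee_wpmul2l; rewrite ?lee_fin.
pose H x := limn_einf (G ^~ x).
have mH : measurable_fun setT H.
  rewrite /H /limn_einf; apply: measurableT_comp => //.
  apply: measurable_fun_limn_esup => k.
  exact: measurableT_comp.
have H0 x : 0 <= H x by apply: (@limn_einf_ge _ _ _ 0%N) => k _.
have HQ : \int[mu]_x H x <= (ratio `^ q * sum_const p A e n)%:E * Q.
  apply: (le_trans (fatou mu measurableT _ _)) => //.
  exact: limn_einf_le.
have key x : maximal mu f x `^ q * (w x)%:E <= (c `^ q)%:E * H x.
  apply: poweR_le_from_below => //; first exact: maximal_ge0.
    by rewrite mule_ge0// lee_fin powR_ge0.
  move=> t t0 tM.
  pose s := (t / c)%R; have s0 : (0 < s)%R by rewrite divr_gt0.
  have -> : (t `^ q * w x = c `^ q * (s `^ q * w x))%R.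
    by rewrite mulrA -powRM ?(ltW s0) ?(ltW c_gt0)// mulrCA mulfV ?mulr1// gt_eqF.
  rewrite EFinM lee_wpmul2l ?lee_fin ?powR_ge0//.
  have [N1 hN1] := maximal_superlevel x0 mf t0 tM.
  have [N2 hN2] := lt_pow_ratio s; have [N3 hN3] := lt_pow_ratio s^-1.
  apply: (@limn_einf_ge _ _ _ (maxn N1 (maxn N2 N3))) => k.
  rewrite !geq_max => /and3P[kN1 kN2 kN3].
  have Us := hN1 _ kN1.
  have ex : exists m, (s < L k m)%R.
    exists (2 * k)%N; rewrite /L mul2n -addnn exprD mulfK ?expf_neq0 ?gt_eqF//.
    exact: hN2.
  case: (ex_minnP ex) => -[|m] sL minm.
    move: sL; rewrite /L expr0 mul1r ltNge => /negP; case.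
    rewrite -(invrK s) lef_pV2 ?posrE ?invr_gt0 ?exprn_gt0//.
    exact/ltW/hN3.
  have mk : (m < 2 * k)%N.
    apply: minm; rewrite /L mul2n -addnn exprD mulfK ?expf_neq0 ?gt_eqF//.
    exact: hN2.
  have Ls : (L k m <= s)%R.
    by rewrite leNgt; apply/negP => /minm; rewrite ltnn.
  have Um : U k m x.
    by apply: superlevel_le Us.
  rewrite /G (bigD1 (Ordinal mk))//=; apply: (@le_trans _ _
    (((ratio * L k m) `^ q)%:E * (\1_(U k m) x * w x)%:E)).
    rewrite -EFinM lee_fin indicE mem_set// mul1r ler_wpM2r ?(ltW (w0 _))//.
    apply: ge0_ler_powR; rewrite ?nnegrE ?(ltW q0) ?(ltW s0)//.
      by rewrite mulr_ge0 ?(ltW (L0 _ _)) ?(ltW ratio_gt0).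
    by apply: ltW; move: sL; rewrite /L exprS mulrA.
  rewrite leeDl//; apply: sume_ge0 => j _; apply: mule_ge0; last exact: Uw0.
  by rewrite lee_fin powR_ge0.
apply: (@le_trans _ _ (\int[mu]_x ((c `^ q)%:E * H x))).
  apply: ge0_le_integral => //.
  - by move=> x _; rewrite mule_ge0 ?poweR_ge0// lee_fin ltW.
  - apply: emeasurable_funM; last exact/measurable_EFinP.
    apply: (measurableT_comp (measurable_poweR q)); exact: maximal_measurable.
  - exact: measurable_funeM.
rewrite ge0_integralZl_EFin ?powR_ge0//.
by rewrite [in leRHS]EFinM -muleA lee_wpmul2l// lee_fin powR_ge0.
Qed.

(** * From the maximal inequality to the weight *)

(** Test with g = min(w^(1/(1-q)), k) on the ball B: since g^(q-1) w <= 1, the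
integral of g^q w is at most that of g, which is finite; on B the maximal
function of g is at least the average of g.  Then let k tend to infinity. *)
Lemma muckenhoupt_of_strong_type (q K : R) (w : X -> R) :
  (1 < q)%R -> (0 <= K)%R ->
  measurable_fun setT w -> (forall x, (0 < w x)%R) ->
  (forall x r, (0 < r)%R -> \int[mu]_(y in ball x r) (w y)%:E < +oo) ->
  (forall f : X -> \bar R, measurable_fun setT f ->
    \int[mu]_x (maximal mu f x `^ q * (w x)%:E) <=
    K%:E * \int[mu]_x (`|f x| `^ q * (w x)%:E)) ->
  Muckenhoupt_bound mu q w K.
Proof.
move=> q1 K0 mw w0 woo strong z r r0.
have v0 : (0 < vol z r)%R by exact: vol_gt0.
have v1 : (0 <= (vol z r)^-1)%R by rewrite invr_ge0 ltW.
have q10 : (0 < q - 1)%R by lra.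
have q0 : (0 < q)%R by lra.
have mB : measurable (ball z r) by exact: ball_is_measurable.
rewrite /average volE// inver gt_eqF//.
set W := \int[mu]_(y in _) (w y)%:E.
have W0 : 0 <= W by apply: integral_ge0 => x _; rewrite lee_fin ltW.
have Wfin : W \is a fin_num by rewrite ge0_fin_numE//; exact: woo.
pose s := (1 / (1 - q))%R.
have ws0 x : (0 <= w x `^ s)%R by rewrite powR_ge0.
have mws : measurable_fun setT (fun x => (w x `^ s)%:E).
  by apply/measurable_EFinP; exact: (measurableT_comp (measurable_powR _) mw).
pose g k := cutoff (fun x => (w x `^ s)%:E) z k.
have g0 k x : (0 <= g k x)%R by exact: cutoff_ge0.
have mg k : measurable_fun setT (g k) by exact: cutoff_measurable.
pose S k := \int[mu]_(x in ball z r) (g k x)%:E.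
have S0 k : 0 <= S k by apply: integral_ge0 => x _; rewrite lee_fin.
have Sfin k : S k \is a fin_num.
  rewrite ge0_fin_numE//; apply: (@le_lt_trans _ _ (\int[mu]_(x in ball z r) (k%:R)%:E)).
    apply: (@le_integral_EFin _ _ _ mu (g k) (cst k%:R)) => // x _.
    exact: cutoff_le.
  by rewrite integral_cst// volE// -EFinM ltry.
have test k : ((vol z r)^-1 * fine W * ((vol z r)^-1 * fine (S k)) `^ (q - 1) <= K)%R.
  set sk := fine (S k).
  have sk0 : (0 <= sk)%R by exact: fine_ge0.
  have [sk_eq0|skn0] := eqVneq sk 0%R.
    by rewrite sk_eq0 mulr0 powR0 ?gt_eqF// mulr0.
  have skp : (0 < sk)%R by rewrite lt_neqAle eq_sym skn0.
  pose h x := (\1_(ball z r) x * g k x)%R.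
  have h0 x : (0 <= h x)%R by rewrite mulr_ge0.
  have mh : measurable_fun setT h by apply: measurable_funM.
  have hB : \int[mu]_(x in ball z r) `|(h x)%:E| = S k.
    apply: eq_integral => x xB; rewrite gee0_abs ?lee_fin//.
    by rewrite /h indicE xB mul1r.
  have := strong (EFin \o h); have mh' : measurable_fun setT (EFin \o h) by exact/measurable_EFinP.
  move=> /(_ mh') => st.
  have low : (((vol z r)^-1 * sk) `^ q)%:E * W <=
      \int[mu]_x (maximal mu (EFin \o h) x `^ q * (w x)%:E).
    rewrite -ge0_integralZl_EFin ?powR_ge0//; last 2 first.
    - by move=> x _; rewrite lee_fin ltW.
    - by apply/measurable_funTS/measurable_EFinP.
    rewrite [leLHS]integral_mkcond; apply: ge0_le_integral => //.
    - move=> x _; rewrite /patch; case: ifP => // _.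
      by rewrite -EFinM lee_fin mulr_ge0 ?powR_ge0// ltW.
    - apply/(measurable_restrictT _ _).1 => //.
      by apply: measurable_funeM; apply/measurable_funTS/measurable_EFinP.
    - apply: emeasurable_funM; last exact/measurable_EFinP.
      apply: (measurableT_comp (measurable_poweR q)); exact: maximal_measurable.
    move=> x _; rewrite /patch; case: ifPn => [/set_mem xB|_]; last first.
      by rewrite mule_ge0 ?poweR_ge0// lee_fin ltW.
    rewrite lee_wpmul2r ?lee_fin ?(ltW (w0 _))// -poweR_EFin.
    apply: gt0_ler_poweR; rewrite ?(ltW q0)//.
    - by rewrite in_itv/= leey lee_fin mulr_ge0.
    - by rewrite in_itv/= leey maximal_ge0.
    - apply: ereal_sup_ubound; exists (z, r) => //=.
      by rewrite /average volE// inver gt_eqF// hB EFinM /sk fineK.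
  have up : \int[mu]_x (`|(EFin \o h) x| `^ q * (w x)%:E) <= S k.
    rewrite /S [leRHS]integral_mkcond; apply: ge0_le_integral => //.
    - by move=> x _; rewrite mule_ge0 ?poweR_ge0// lee_fin ltW.
    - apply: emeasurable_funM; last exact/measurable_EFinP.
      apply: (measurableT_comp (measurable_poweR q)); exact: measurableT_comp.
    - apply/(measurable_restrictT _ _).1 => //.
      by apply/measurable_funTS/measurable_EFinP.
    move=> x _; rewrite /= ger0_norm// /h /patch indicE.
    case: ifP => _; last by rewrite mul0r powR0 ?mul0e// gt_eqF.
    rewrite mul1r -EFinM lee_fin.
    have gw : (g k x <= w x `^ s)%R.
      by have := cutoff_abs_le (fun x => (w x `^ s)%:E) z k x; rewrite gee0_abs ?lee_fin.
    rewrite [X in (_ `^ X * _ <= _)%R](_ : q = (q - 1) + 1)%R; last by ring.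
    rewrite powRD; last by rewrite subrK gt_eqF.
    rewrite powRr1// mulrAC ler_piMl//.
    apply: (@le_trans _ _ ((w x `^ s) `^ (q - 1) * w x)%R).
      rewrite ler_wpM2r ?(ltW (w0 _))//.
      by apply: ge0_ler_powR; rewrite ?nnegrE ?(ltW q10).
    rewrite -powRrM (_ : s * (q - 1) = -1)%R; last first.
      by rewrite /s; field; rewrite subr_eq0 lt_eqF.
    by rewrite powR_inv1 ?(ltW (w0 _))// mulVf// gt_eqF.
  have := le_trans low (le_trans st (lee_wpmul2l _ up)).
  rewrite lee_fin => /(_ K0).
  rewrite -(fineK Wfin) -(fineK (Sfin k)) -/sk -!EFinM lee_fin => H.
  rewrite -(ler_pM2r skp); apply: le_trans H.
  have vs : (0 < (vol z r)^-1 * sk)%R by rewrite mulr_gt0// invr_gt0.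
  rewrite [X in (_ <= _ `^ X * _)%R](_ : q = (q - 1) + 1)%R; last by ring.
  rewrite [in leRHS]powRD; last by rewrite subrK gt_eqF.
  rewrite (powRr1 (ltW vs)).
  rewrite le_eqVlt; apply/orP; left; apply/eqP; ring.
have [a0|an0] := eqVneq ((vol z r)^-1 * fine W)%R 0%R.
  by rewrite -(fineK Wfin) -EFinM a0 mul0e lee_fin.
rewrite muleC -(fineK Wfin) -EFinM.
apply: poweR_le_from_below => //.
- rewrite lt_neqAle eq_sym an0/=; rewrite mulr_ge0// fine_ge0//.
- apply: mule_ge0; first by rewrite lee_fin.
  by apply: integral_ge0 => x _; rewrite lee_fin.
move=> t t0 tT.
have Snd : nondecreasing_seq S.
  move=> k l kl; apply: le_integral_EFin => // x _.
  exact: cutoff_nondecreasing.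
have E : \int[mu]_(y in ball z r) (w y `^ s)%:E = ereal_sup (range S).
  rewrite -(cvg_lim _ (ereal_nondecreasing_cvgn Snd))//.
  rewrite /S -monotone_convergence//; last 3 first.
  - by move=> k; apply/measurable_funTS/measurable_EFinP.
  - by move=> k x _; rewrite lee_fin.
  - by move=> x _ k l kl; rewrite lee_fin; exact: cutoff_nondecreasing.
  apply: eq_integral => y _; apply/esym/cvg_lim => //.
  have := @cutoff_cvg (fun x => (w x `^ s)%:E) z y.
  by rewrite gee0_abs ?lee_fin.
have vi0 : (0 < (vol z r)^-1)%R by rewrite invr_gt0.
have [_ [k _ <-] tS] : exists2 y, range S y & (vol z r * t)%:E < y.
  apply: ereal_sup_gt; rewrite -E.
  by move: tT; rewrite muleC lte_pdivlMr// -EFinM (mulrC t).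
rewrite lee_fin; apply: le_trans (test k); rewrite mulrC ler_wpM2l//.
  by rewrite mulr_ge0// fine_ge0.
apply: ge0_ler_powR; rewrite ?nnegrE ?(ltW q10) ?(ltW t0)//.
  by rewrite mulr_ge0// fine_ge0.
rewrite ler_pdivlMl// ltW// -lte_fin fineK//.
Qed.

End doubling_space.

(** * Choice of the exponent *)
Section exponents.
Context {R : realType}.
Implicit Types c p A : R.
Local Open Scope ring_scope.

(** The number n of levels, chosen so that n^(p-1) >= 4 D for
D = level_const c p A. *)
Definition level_count c p A : nat :=
  (Num.truncn ((4 * level_const c p A) `^ (p - 1)^-1)).+1.

(** The second term ensures (ratio^n)^e <= 2, the first one e < p - 1. *)
Definition exponent_gain c p A : R :=
  Num.min ((p - 1) / 2) (ln 2 / ln (ratio c ^+ level_count c p A)).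

Definition improved_bound c p A : R :=
  let q := p - exponent_gain c p A in
  c `^ q * (ratio c `^ q *
    sum_const c p A (exponent_gain c p A) (level_count c p A)).

Let ratio_gt1 c : 1 < c -> 1 < ratio c.
Proof.
move=> c1; have : 1 <= c ^+ 2 by rewrite exprn_ege1// ltW.
by rewrite /ratio; lra.
Qed.

Lemma level_const_ge0 c p A : 1 < c -> 0 <= A -> 0 <= level_const c p A.
Proof. by move=> c1 A0; rewrite /level_const !mulr_ge0 ?powR_ge0. Qed.

Lemma level_countP c p A : 1 < c -> 1 < p -> 0 <= A ->
  level_const c p A * ((level_count c p A)%:R^-1 `^ p * 2 * (level_count c p A)%:R)
    <= 2^-1.
Proof.
move=> c1 p1 A0; set D := level_const c p A; set n := level_count c p A.
have D0 : 0 <= D by exact: level_const_ge0.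
have p10 : 0 < p - 1 by lra.
have n0 : 0 < n%:R :> R by rewrite ltr0n.
have nD : (4 * D) `^ (p - 1)^-1 <= n%:R by rewrite ltW// truncnS_gt.
have Dn : 4 * D <= n%:R `^ (p - 1).
  have -> : 4 * D = ((4 * D) `^ (p - 1)^-1) `^ (p - 1).
    by rewrite -powRrM mulVf ?gt_eqF// powRr1// mulr_ge0.
  by apply: ge0_ler_powR; rewrite ?nnegrE ?powR_ge0 ?(ltW p10) ?(ltW n0).
have np : n%:R^-1 `^ p * n%:R * n%:R `^ (p - 1) = 1.
  rewrite -mulrA -[X in _ * (X * _)](powRr1 (ltW n0)) -powRD; last first.
    by rewrite (gt_eqF n0) implybT.
  by rewrite addrC subrK -powRM ?invr_ge0 ?(ltW n0)// mulVf ?gt_eqF// powR1.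
have t0 : 0 <= n%:R^-1 `^ p * n%:R by rewrite mulr_ge0 ?powR_ge0 ?(ltW n0).
have := ler_wpM2l t0 Dn; rewrite np.
set t := _ `^ p * _; rewrite (_ : _ `^ p * 2 * _ = 2 * t); last by rewrite /t; ring.
lra.
Qed.

Lemma exponent_gain_bounds c p A : 1 < c -> 1 < p ->
  0 < exponent_gain c p A < p - 1.
Proof.
move=> c1 p1; have ln2 : 0 < ln 2 :> R by rewrite ln_gt0//; lra.
have lnr : 0 < ln (ratio c ^+ level_count c p A).
  by rewrite ln_gt0// exprn_egt1// ratio_gt1.
rewrite lt_min divr_gt0 ?subr_gt0//= divr_gt0//= gt_min; apply/orP; left; lra.
Qed.

Lemma exponent_gainP c p A : 1 < c -> 1 < p ->
  (ratio c ^+ level_count c p A) `^ exponent_gain c p A <= 2.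
Proof.
move=> c1 p1; set r := ratio c ^+ _.
have lnr : 0 < ln r by rewrite ln_gt0// exprn_egt1// ratio_gt1.
have r0 : 0 < r by rewrite exprn_gt0// (lt_trans _ (ratio_gt1 c1)).
rewrite /powR gt_eqF// -[leRHS]lnK ?posrE// ler_expR -ler_pdivlMr//.
by rewrite /exponent_gain -/r ge_min lexx orbT.
Qed.
End exponents.

(** * The theorem *)
Lemma muckenhoupt_bound_ge0 (R : realType) d (X : metricMeasurableType R d)
    (mu : {measure set X -> \bar R}) (q C : R) (w : X -> R) (x : X) :
  (forall y, (0 <= w y)%R) -> Muckenhoupt_bound mu q w C -> (0 <= C)%R.
Proof.
move=> w0 /(_ x 1%R ltr01); rewrite -lee_fin; apply: le_trans.
rewrite mule_ge0 ?poweR_ge0// /average mule_ge0 ?inve_ge0//.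
by apply: integral_ge0 => y _; rewrite lee_fin.
Qed.

Lemma eq_integral_ae_pos d (T : measurableType d) (R : realType)
  (mu : {measure set T -> \bar R}) (w : T -> R) (D : set T) (f g : T -> \bar R) :
  {ae mu, forall x, (0 < w x)%R} -> measurable D ->
  measurable_fun D f -> measurable_fun D g ->
  (forall x, (0 < w x)%R -> f x = g x) ->
  \int[mu]_(x in D) f x = \int[mu]_(x in D) g x.
Proof.
move=> w0 mD mf mg fg; apply: ae_eq_integral => //.
by apply: filterS w0 => x wx _; exact: fg.
Qed.

Theorem theorem5p11 (R : realType) :
  exists eps C1 C2 : R -> R -> R -> R,
  forall (d : measure_display) (X : metricMeasurableType R d)
    (mu : {measure set X -> \bar R}) (cmu : R),
  complete_borel_measure mu ->
  ball_measure_pos_finite mu ->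
  (exists x y : X, x <> y) ->
  (1 < cmu)%R ->
  doubling mu cmu ->
  forall (p : R) (w : X -> R),
  (1 < p)%R ->
  Muckenhoupt mu p w ->
  let A := Muckenhoupt_const mu p w in
  let e := eps cmu p A in
  [/\ (0 < e < p - 1)%R,
      Muckenhoupt mu (p - e)%R w,
      (Muckenhoupt_const mu (p - e)%R w <= C1 cmu p A)%R &
      forall f : X -> \bar R, weighted_Lq mu (p - e)%R w f ->
        \int[mu]_x (maximal mu f x `^ (p - e) * (w x)%:E)
        <= (C2 cmu p A)%:E * \int[mu]_x (`|f x| `^ (p - e) * (w x)%:E)].
Proof.
exists (fun c p A => exponent_gain c p (A + 1))%R,
  (fun c p A => improved_bound c p (A + 1))%R,
  (fun c p A => improved_bound c p (A + 1))%R.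
move=> d X mu c cb bp [x0 _] c1 db p w p1 [[mw wi w0] [C0 wC0]] A.
(* a weight that is positive everywhere and equal to w almost everywhere *)
pose w' x := if (0 < w x)%R then w x else 1%R.
have w'0 x : (0 < w' x)%R by rewrite /w'; case: ifP.
have mw' : measurable_fun setT w'.
  apply: measurable_fun_ifT => //; exact: measurable_fun_ltr.
have w'E x : (0 < w x)%R -> w' x = w x by rewrite /w' => ->.
have mwE : measurable_fun setT (EFin \o w) by exact/measurable_EFinP.
have mwE' : measurable_fun setT (EFin \o w') by exact/measurable_EFinP.
have mB (x : X) (r : R) : measurable (ball x r) by exact: ball_is_measurable.
have woo x r : (0 < r)%R -> \int[mu]_(y in ball x r) (w' y)%:E < +oo.
  move=> r0; have /integrableP[_] := wi x r r0; apply: le_lt_trans.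
  rewrite le_eqVlt; apply/orP; left; apply/eqP.
  apply: (eq_integral_ae_pos w0) => //.
  - exact: measurable_funTS.
  - by apply/measurable_funTS; exact: measurableT_comp.
  - by move=> y wy; rewrite w'E//= ger0_norm// ltW.
have bndE q C : Muckenhoupt_bound mu q w' C <-> Muckenhoupt_bound mu q w C.
  have E x r : average mu (ball x r) (fun y => (w' y)%:E) =
      average mu (ball x r) (fun y => (w y)%:E).
    congr (_ * _); apply: (eq_integral_ae_pos w0) => //.
    - exact: measurable_funTS.
    - exact: measurable_funTS.
    - by move=> y wy; rewrite w'E.
  have Es x r : average mu (ball x r) (fun y => (w' y `^ (1 / (1 - q)))%:E) =
      average mu (ball x r) (fun y => (w y `^ (1 / (1 - q)))%:E).
    congr (_ * _); apply: (eq_integral_ae_pos w0) => //.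
    - apply/measurable_funTS/measurable_EFinP.
      exact: (measurableT_comp (measurable_powR _) mw').
    - apply/measurable_funTS/measurable_EFinP.
      exact: (measurableT_comp (measurable_powR _) mw).
    - by move=> y wy; rewrite w'E.
  by split=> H x r r0; have := H x r r0; rewrite E Es.
have bnd_ge0 q C : Muckenhoupt_bound mu q w C -> (0 <= C)%R.
  by move=> /bndE; apply: (muckenhoupt_bound_ge0 x0) => y; exact: ltW.
have lbA q : has_lbound [set C | Muckenhoupt_bound mu q w C].
  by exists 0%R => C /bnd_ge0.
have infA : has_inf [set C | Muckenhoupt_bound mu p w C] by split => //; exists C0.
have A0 : (0 <= A)%R by apply: lb_le_inf; [exists C0|move=> C /bnd_ge0].
have A10 : (0 < A + 1)%R by lra.
(* A + 1 is a bound without having to know that the infimum A is attained *)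
have bndA : Muckenhoupt_bound mu p w (A + 1)%R.
  have [C wC CA] := inf_adherent ltr01 infA.
  move=> x r r0; apply: (le_trans (wC x r r0)).
  by rewrite lee_fin ltW.
move=> e.
have /andP[e0 ep1] : (0 < e < p - 1)%R by exact: exponent_gain_bounds.
set n := level_count c p (A + 1).
have Dn := level_countP c1 p1 (ltW A10).
have an := exponent_gainP (A + 1) c1 p1.
set q := (p - e)%R.
have q1 : (1 < q)%R by rewrite /q; lra.
have strong f : measurable_fun setT f ->
    \int[mu]_x (maximal mu f x `^ q * (w' x)%:E) <=
    (improved_bound c p (A + 1))%:E * \int[mu]_x (`|f x| `^ q * (w' x)%:E).
  have ep : (0 < e < p)%R by rewrite e0/=; lra.
  move=> mf; exact: (strong_type cb bp c1 db x0 p1 A10 ep (ltn0Sn _) mw' w'0 woo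
    ((bndE p (A + 1)%R).2 bndA) Dn an mf).
have I0 : (0 <= improved_bound c p (A + 1))%R.
  have D0 := level_const_ge0 p c1 (ltW A10).
  rewrite /improved_bound mulr_ge0 ?powR_ge0// mulr_ge0 ?powR_ge0//.
  by rewrite /sum_const; apply: mulr_ge0; [exact: mulr_ge0|rewrite mulr_ge0 ?powR_ge0].
have bndq : Muckenhoupt_bound mu q w (improved_bound c p (A + 1)).
  by apply/bndE; exact: (muckenhoupt_of_strong_type cb bp q1 I0 mw' w'0 woo strong).
split => //.
- by rewrite e0.
- by split; [|exists (improved_bound c p (A + 1))].
- exact: ge_inf.
move=> f [mf _].
have mg g : measurable_fun setT g -> forall v : X -> R, measurable_fun setT v ->
    measurable_fun setT (fun x => g x `^ q * (v x)%:E).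
  move=> mg v mv; apply: emeasurable_funM; last exact/measurable_EFinP.
  exact: (measurableT_comp (measurable_poweR q)).
have -> : \int[mu]_x (maximal mu f x `^ q * (w x)%:E) =
    \int[mu]_x (maximal mu f x `^ q * (w' x)%:E).
  apply: (eq_integral_ae_pos w0) => //.
  - by apply: mg => //; exact: maximal_measurable.
  - by apply: mg => //; exact: maximal_measurable.
  - by move=> x wx; rewrite w'E.
have -> : \int[mu]_x (`|f x| `^ q * (w x)%:E) = \int[mu]_x (`|f x| `^ q * (w' x)%:E).
  apply: (eq_integral_ae_pos w0) => //.
  - by apply: mg => //; exact: measurableT_comp.
  - by apply: mg => //; exact: measurableT_comp.
  - by move=> x wx; rewrite w'E.
exact: strong.
Qed.
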